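(* Let $\Sigma$ be a complete fan, let $\mathcal{E}$ be a tropical vector bundle on the toric variety $X_\Sigma$, and let $\alpha_{\mathcal{E}}: M_{\mathbb{R}}\to\mathbb{Z}$ be its associated convex chain. Then for every character $u\in M$, $$\chi(X_\Sigma,\mathcal{E})_u=\alpha_{\mathcal{E}}(u).$$
   Context: Let $N\cong\mathbb{Z}^n$ be a lattice with dual lattice $M$ (the character lattice), pairing $\langle\cdot,\cdot\rangle:M\times N\to\mathbb{Z}$, and $M_{\mathbb{R}}=M\otimes\mathbb{R}$, $N_{\mathbb{R}}=N\otimes\mathbb{R}$. $\Sigma$ is a complete fan of strictly convex rational polyhedral cones in $N_{\mathbb{R}}$; $\Sigma(1)$ is its set of rays, $\sigma(1)$ the set of rays of a cone $\sigma$, $\mathbf{v}_\rho\in N$ the primitive generator of a ray $\rho$, and $\operatorname{codim}(\sigma)=n-\dim\sigma$. Tropical vector bundle. A tropical vector bundle $\mathcal{E}$ of rank $r$ over $X_\Sigma$ consists of a matroid $\mathcal{M}$ of rank $r$ on a finite ground set $\mathcal{G}$ and, for each $\rho\in\Sigma(1)$, a decreasing filtration $(F^\rho_i)_{i\in\mathbb{Z}}$ by flats of $\mathcal{M}$, such that for each $\sigma\in\Sigma$ there are a basis $B_\sigma=\{b_{\sigma,1},\dots,b_{\sigma,r}\}$ of $\mathcal{M}$ and a multiset of characters $u(\sigma)=\{u_{\sigma,1},\dots,u_{\sigma,r}\}\subset M$ with $F^\rho_i=\operatorname{span}\{b_{\sigma,j}\mid\langle u_{\sigma,j},\mathbf{v}_\rho\rangle\ge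 i\}$ for all $\rho\in\sigma(1)$, $i\in\mathbb{Z}$. Here $\operatorname{span}$ is matroid closure. Euler characteristic. For $\sigma\in\Sigma$ and $u\in M$ let $H^0(U_\sigma,\mathcal{E}|_{U_\sigma})_u=\bigcap_{\rho\in\sigma(1)}F^\rho_{\langle u,\mathbf{v}_\rho\rangle}$, a flat of $\mathcal{M}$ (equal to $\mathcal{G}$ when $\sigma=\{0\}$). The equivariant Euler characteristic is $\chi(X_\Sigma,\mathcal{E})_u=\sum_{\sigma\in\Sigma}(-1)^{\operatorname{codim}(\sigma)}\operatorname{rank}H^0(U_\sigma,\mathcal{E}|_{U_\sigma})_u$. Convex chains. A convex chain is a function $\alpha:M_{\mathbb{R}}\to\mathbb{Z}$ of the form $\alpha=\sum_{i=1}^k n_i\mathbb{1}_{P_i}$ with $n_i\in\mathbb{Z}$ and $P_i\subset M_{\mathbb{R}}$ convex polytopes. Its support function is the function $N_{\mathbb{R}}\to\mathbb{Z}[\mathbb{R}]$, $x\mapsto\sum_i n_i[\mathfrak{h}_{P_i}(x)]$, where $\mathfrak{h}_P(x)=\max_{u\in P}\langle u,x\rangle$ and $\mathbb{Z}[\mathbb{R}]$ is the group ring of the additive group $\mathbb{R}$. It is known (Khovanskii–Pukhlikov) that sending a convex chain to its support function is an isomorphism onto the algebra of multi-valued piecewise linear functions; in particular a convex chain is determined by its support function. Convex chain of $\mathcal{E}$. The multi-valued support function of $\mathcal{E}$ is $\mathfrak{h}_{\mathcal{E}}:N_{\mathbb{R}}\to\mathbb{Z}[\mathbb{R}]$, $\mathfrak{h}_{\mathcal{E}}(x)=\sum_{i=1}^r[\langle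 u_{\sigma,i},x\rangle]$ for $x\in\sigma\in\Sigma$ (well defined), and $\alpha_{\mathcal{E}}$ is the unique convex chain whose support function is $\mathfrak{h}_{\mathcal{E}}$. *)

(* Defs.v *)
From mathcomp Require Import all_boot all_order all_algebra finmap.
From mathcomp Require Import boolp classical_sets reals.
From mathcomp.multinomials Require Import monalg.

Set Implicit Arguments.
Unset Strict Implicit.
Unset Printing Implicit Defensive.

Import Order.TTheory GRing.Theory Num.Theory.
Local Open Scope classical_set_scope.
Local Open Scope ring_scope.

Section Matroid.
Variable G : finType.

(* The finite type [G] is the ground set; loops and parallel elements are
   allowed. *)
Record matroid := Matroid {
  indep : pred {set G};
  indep0 : indep finset.set0;
  indep_sub : forall A B : {set G}, A \subset B -> indep B -> indep A;
  indep_aug : forall A B : {set G}, indep A -> indep B -> (#|A| < #|B|)%N ->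
    exists2 x, x \in B :\: A & indep (x |: A)
}.

Variable M : matroid.

Definition mrank (A : {set G}) : nat :=
  \max_(I : {set G} | indep M I && (I \subset A)) #|I|.

Definition mspan (A : {set G}) : {set G} :=
  [set x | mrank (x |: A) == mrank A]%SET.

Definition flat (A : {set G}) : bool := mspan A == A.

Definition mbasis (B : {set G}) : bool := maxset (indep M) B.

End Matroid.

(* The lattice N is the column vectors 'cV[int]_n and its dual M the row
   vectors 'rV[int]_n; likewise N_R = 'cV[R]_n and M_R = 'rV[R]_n. *)
Definition pairing (K : pzRingType) (n : nat) (u : 'rV[K]_n) (x : 'cV[K]_n) : K :=
  (u *m x) ord0 ord0.

Definition latR (R : realType) (m n : nat) (v : 'M[int]_(m, n)) : 'M[R]_(m, n) :=
  map_mx intr v.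

Section Fans.
Variables (R : realType) (n : nat).
Implicit Types (s t : set 'cV[R]_n).

Definition rational_cone s : Prop :=
  exists k (v : 'I_k -> 'cV[int]_n),
    s = [set \sum_i c i *: latR R (v i) | c in [set c : 'I_k -> R | forall i, 0 <= c i]].

Definition strictly_convex s : Prop := forall x, s x -> s (- x) -> x = 0.

Definition face t s : Prop :=
  exists2 u : 'rV[R]_n, (forall x, s x -> 0 <= pairing u x)
    & t = s `&` [set x | pairing u x = 0].

(* The default 0 is never used: a smallest subspace containing [s] exists. *)
Definition linear_span s : {vspace 'cV[R]_n} :=
  xget 0%VS [set U : {vspace 'cV[R]_n} |
    s `<=` [set` U] /\ forall W : {vspace 'cV[R]_n}, s `<=` [set` W] -> (U <= W)%VS].

Definition cone_dim s : nat := \dim (linear_span s).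

Record fan := Fan {
  cones :> {fset (set 'cV[R]_n)};
  fan_cone : forall s, s \in cones -> rational_cone s /\ strictly_convex s;
  fan_face : forall s t, s \in cones -> face t s -> t \in cones;
  fan_meet : forall s t, s \in cones -> t \in cones ->
    face (s `&` t) s /\ face (s `&` t) t
}.

Definition complete (Sigma : fan) : Prop :=
  forall x : 'cV[R]_n, exists2 s, s \in cones Sigma & s x.

Definition fan_rays (Sigma : fan) : set (set 'cV[R]_n) :=
  [set rho | rho \in cones Sigma /\ cone_dim rho = 1%N].

Definition cone_rays s : set (set 'cV[R]_n) :=
  [set rho | face rho s /\ cone_dim rho = 1%N].

Definition primitive (v : 'cV[int]_n) : Prop :=
  forall (k : int) (w : 'cV[int]_n), v = k *: w -> `|k| = 1.

(* The default 0 is never used when [rho] is a ray of a rational fan. *)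
Definition ray_gen (rho : set 'cV[R]_n) : 'cV[int]_n :=
  xget 0 [set v | primitive v /\
    rho = [set c *: latR R v | c in [set c : R | 0 <= c]]].

End Fans.

Section TropicalBundle.
Variables (R : realType) (n : nat) (Sigma : fan R n) (r : nat).

(* [b] enumerates the basis B_sigma and [u] the multiset u(sigma). *)
Definition splits_on (G : finType) (M : matroid G)
    (F : set 'cV[R]_n -> int -> {set G}) (s : set 'cV[R]_n)
    (b : 'I_r -> G) (u : 'I_r -> 'rV[int]_n) : Prop :=
  [/\ injective b, mbasis M [set b j | j : 'I_r]%SET
    & forall rho (i : int), cone_rays s rho ->
        F rho i = mspan M [set b j | j : 'I_r & i <= pairing (u j) (ray_gen rho)]%SET].

(* [filt rho] is only meaningful when [rho] is a ray of [Sigma]. *)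
Record tropical_bundle := TropicalBundle {
  ground : finType;
  mat : matroid ground;
  mat_rank : mrank mat [set: ground]%SET = r;
  filt : set 'cV[R]_n -> int -> {set ground};
  filt_flat : forall rho i, fan_rays Sigma rho -> flat mat (filt rho i);
  filt_decr : forall rho i j, fan_rays Sigma rho -> i <= j ->
    filt rho j \subset filt rho i;
  filt_split : forall s, s \in cones Sigma -> exists b u, splits_on mat filt s b u
}.

Variable E : tropical_bundle.

Definition H0 (s : set 'cV[R]_n) (u : 'rV[int]_n) : {set ground E} :=
  [set x | `[< forall rho, cone_rays s rho ->
                 x \in filt E rho (pairing u (ray_gen rho)) >]]%SET.

Definition euler_char (u : 'rV[int]_n) : int :=
  \sum_(s <- cones Sigma) (-1) ^+ (n - cone_dim s) * (mrank (mat E) (H0 s u))%:Z.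

(* {malg int[R]} is the free abelian group on the set R, that is, the additive
   group of the group ring Z[R] (the product of Z[R] plays no role here), and
   << a >> is the basis element [a].  The value does not depend on the choice of
   the cone s containing x, nor on that of b and u; the default 0 is never used
   when [Sigma] is complete. *)
Definition mv_support (x : 'cV[R]_n) : {malg int[R]} :=
  xget 0 [set h | exists s b u,
    [/\ s \in cones Sigma, s x, splits_on (mat E) (filt E) s b u
      & h = \sum_(j < r) << pairing (latR R (u j)) x >>]].

End TropicalBundle.

Section ConvexChains.
Variables (R : realType) (n : nat).

Definition polytope (P : set 'rV[R]_n) : Prop :=
  exists k (p : 'I_k.+1 -> 'rV[R]_n),
    P = [set \sum_i c i *: p i |
          c in [set c : 'I_k.+1 -> R | (forall i, 0 <= c i) /\ \sum_i c i = 1]].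

(* The maximum defining the support function of a polytope is attained, hence
   equal to the supremum. *)
Definition polytope_support (P : set 'rV[R]_n) (x : 'cV[R]_n) : R :=
  sup [set pairing u x | u in P].

(* A list of pairs (n_i, P_i) stands for the formal sum of the n_i 1_{P_i}. *)
Definition chain_fun (c : seq (int * set 'rV[R]_n)) (u : 'rV[R]_n) : int :=
  \sum_(p <- c) p.1 * (u \in p.2)%:R.

Definition chain_support (c : seq (int * set 'rV[R]_n)) (x : 'cV[R]_n) :
    {malg int[R]} :=
  \sum_(p <- c) << p.1 *g polytope_support p.2 x >>.

Definition convex_chain_with_support (alpha : 'rV[R]_n -> int)
    (h : 'cV[R]_n -> {malg int[R]}) : Prop :=
  exists c : seq (int * set 'rV[R]_n),
    [/\ forall p, p \in c -> polytope p.2,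
        forall u, alpha u = chain_fun c u
      & forall x, h x = chain_support c x].

End ConvexChains.

(* A convex chain is determined by its support function, so at most one [alpha]
   satisfies this predicate: it is alpha_E. *)
Definition is_convex_chain_of (R : realType) (n : nat) (Sigma : fan R n) (r : nat)
    (E : tropical_bundle Sigma r) (alpha : 'rV[R]_n -> int) : Prop :=
  convex_chain_with_support alpha (mv_support E).

(* Main.v *)
(* Fix [u].  By definition of the support function, for every [x] in the relative
   interior of a cone [s], the weighted number of polytopes of the chain with
   [h_P(x) >= <u, x>] equals the number of [j] with [<u_(s,j) - u, x> >= 0].
   Integrate both sides over [N_R] against the compactly supported Euler
   characteristic.  The set [h_P >= u] contributes [(-1)^n] if [u] is in [P],
   and [0] otherwise, since then its complement is a nonempty open convex cone.
   The part of the relative interior of [s] where [u_(s,j) - u >= 0] contributes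
   [(-1)^(dim s)] if [u_(s,j) - u >= 0] on all of [s], and [0] otherwise; the
   number of such [j] is the rank of [H^0(U_s, E)_u]. *)
From mathcomp Require Import all_boot all_order all_algebra finmap.
From mathcomp Require Import boolp classical_sets reals.
From mathcomp.multinomials Require Import monalg.
From mathcomp Require Import lra zify.
Require Import Defs.

Set Implicit Arguments.
Unset Strict Implicit.
Unset Printing Implicit Defensive.

Import Order.TTheory GRing.Theory Num.Theory.
Local Open Scope classical_set_scope.
Local Open Scope ring_scope.

(** * Pairings and Fourier-Motzkin elimination *)

(** The integral is kept combinatorial: a finite list [L] of linear hyperplanes cuts the space into
    cells indexed by sign vectors, and a cell, being convex and relatively open, counts with the
    parity of its dimension. The decisive property is additivity under a single cut. It makes the
    integral of the indicator of a cell insensitive to additional hyperplanes, so the arrangements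
    belonging to the various polytopes and cones can be merged into one list. An equality in Z[R] is
    turned into counts by summing the coefficients at exponents that are at least a threshold. Since
    the value of the support function comes from an arbitrary cone and splitting, these counts have
    to be independent of that choice. On the matroid side the obstacle is that flats need not meet
    modularly; flats spanned by parts of one basis do, and intersect like their index sets. *)

Section Pairing.
Variables (R : realType) (n : nat).
Implicit Types (u w : 'rV[R]_n) (x y : 'cV[R]_n).

Lemma pairingDl u w x : pairing (u + w) x = pairing u x + pairing w x.
Proof. by rewrite /pairing mulmxDl mxE. Qed.

Lemma pairingNl u x : pairing (- u) x = - pairing u x.
Proof. by rewrite /pairing mulNmx mxE. Qed.

Lemma pairingBl u w x : pairing (u - w) x = pairing u x - pairing w x.
Proof. by rewrite pairingDl pairingNl. Qed.

Lemma pairingZl a u x : pairing (a *: u) x = a * pairing u x.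
Proof. by rewrite /pairing -scalemxAl mxE. Qed.

Lemma pairing_suml I (s : seq I) (P : pred I) (F : I -> 'rV[R]_n) x :
  pairing (\sum_(i <- s | P i) F i) x = \sum_(i <- s | P i) pairing (F i) x.
Proof. by rewrite /pairing mulmx_suml summxE. Qed.

Lemma pairingDr u x y : pairing u (x + y) = pairing u x + pairing u y.
Proof. by rewrite /pairing mulmxDr mxE. Qed.

Lemma pairingNr u x : pairing u (- x) = - pairing u x.
Proof. by rewrite /pairing mulmxN mxE. Qed.

Lemma pairingBr u x y : pairing u (x - y) = pairing u x - pairing u y.
Proof. by rewrite pairingDr pairingNr. Qed.

Lemma pairingZr a u x : pairing u (a *: x) = a * pairing u x.
Proof. by rewrite /pairing -scalemxAr mxE. Qed.

Lemma pairing0r u : pairing u 0 = 0.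
Proof. by rewrite /pairing mulmx0 mxE. Qed.

Lemma pairing_sumr I (s : seq I) (P : pred I) u (F : I -> 'cV[R]_n) :
  pairing u (\sum_(i <- s | P i) F i) = \sum_(i <- s | P i) pairing u (F i).
Proof. by rewrite /pairing mulmx_sumr summxE. Qed.

Lemma pairing_delta i x : pairing (delta_mx ord0 i) x = x i ord0.
Proof. by rewrite /pairing -rowE mxE. Qed.

Lemma pairing_latR (u : 'rV[int]_n) (v : 'cV[int]_n) :
  pairing (latR R u) (latR R v) = (pairing u v)%:~R.
Proof. by rewrite /pairing /latR -map_mxM mxE. Qed.

End Pairing.

(* Fourier-Motzkin elimination of the coefficient of one generator at a time. *)
Lemma cone_halfspaces (R : realType) n k (v : 'I_k -> 'cV[R]_n) :
  exists A : seq 'rV[R]_n, forall y,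
    (exists2 c : 'I_k -> R, forall i, 0 <= c i & y = \sum_i c i *: v i) <->
    {in A, forall a, 0 <= pairing a y}.
Proof.
elim: k v => [|k IHk] v.
  exists ([seq delta_mx ord0 i | i : 'I_n] ++ [seq - delta_mx ord0 i | i : 'I_n]).
  move=> y; split=> [[c _ ->] a _|yA]; first by rewrite big_ord0 pairing0r.
  exists (fun=> 0) => //; rewrite big_ord0; apply/colP=> i; rewrite !mxE.
  apply/eqP; rewrite eq_le -!(pairing_delta i) -oppr_ge0 -pairingNl !yA //.
    by rewrite mem_cat map_f ?mem_enum.
  by rewrite mem_cat [X in _ || X]map_f ?mem_enum ?orbT.
have [A HA] := IHk (fun i => v (lift ord0 i)).
set v0 := v ord0.
pose A1 := [seq a <- A | 0 <= pairing a v0].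
pose A2 := [seq pairing a v0 *: b - pairing b v0 *: a |
   a <- [seq a <- A | 0 < pairing a v0], b <- [seq b <- A | pairing b v0 < 0]].
exists (A1 ++ A2) => y; split.
  case=> c c0 ->; rewrite big_ord_recl -/v0.
  set y' := \sum_(i < k) _.
  have y'A : {in A, forall a, 0 <= pairing a y'}.
    by apply/HA; exists (fun i => c (lift ord0 i)).
  move=> a; rewrite mem_cat => /orP[|].
    rewrite mem_filter => /andP[a0 aA].
    by rewrite pairingDr pairingZr addr_ge0 ?mulr_ge0 ?y'A.
  case/allpairsP=> -[a1 b] /= [].
  rewrite !mem_filter => /andP[a0 aA] /andP[b0 bA] ->.
  rewrite pairingBl !pairingZl !pairingDr !pairingZr.
  have := mulr_ge0 (ltW a0) (y'A _ bA).
  have : 0 <= - pairing b v0 * pairing a1 y'.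
    by rewrite mulr_ge0 ?y'A // oppr_ge0 ltW.
  by move: (c ord0) => *; nra.
move=> yA.
(* For [y - c *: v0] to satisfy [A], the forms negative on [v0] bound [c] from below and those
   positive on [v0] bound it from above. The greatest lower bound is taken; [A1] and [A2] say that
   it respects every upper bound. *)
pose c := \big[Num.max/0]_(b <- A | pairing b v0 < 0) (pairing b y / pairing b v0).
have c0 : 0 <= c by exact: bigmax_ge_id.
have cA : {in A, forall a, 0 <= pairing a (y - c *: v0)}.
  move=> a aA; rewrite pairingBr pairingZr subr_ge0.
  have [a0|a0] := ltP (pairing a v0) 0.
    rewrite -ler_ndivrMr //.
    rewrite /c; apply: (@le_bigmax_seq _ R _ A 0 a (fun b => pairing b v0 < 0)
      (fun b => pairing b y / pairing b v0)) => //.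
  rewrite /c big_seq_cond; elim/big_ind: _ => [|d e|b /andP[bA b0]].
  - by rewrite mul0r yA // mem_cat mem_filter a0 aA.
  - by move=> Hd He; rewrite maxEle; case: ifP.
  - move: a0; rewrite le_eqVlt => /predU1P[a0|a0].
      by rewrite -a0 mulr0 yA // mem_cat mem_filter aA -a0 lexx.
    rewrite mulrAC ler_ndivrMr // -subr_ge0 mulrC (mulrC (pairing a y)).
    rewrite -!pairingZl -pairingBl yA // mem_cat; apply/orP; right.
    by apply/allpairsP; exists (a, b); rewrite !mem_filter a0 aA b0 bA.
have /HA[d d0 yd] := cA.
exists (fun i => if unlift ord0 i is Some j then d j else c).
  by move=> i; case: unliftP.
rewrite big_ord_recl unlift_none; under eq_bigr do rewrite liftK.
by rewrite -yd addrC subrK.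
Qed.

(** * Open cones *)

Lemma sgr_addr (R : realType) (a b : R) :
  Num.sg a = Num.sg b -> Num.sg (a + b) = Num.sg a.
Proof.
case: (ltrgt0P a) => [a0|a0|->]; rewrite ?sgr0.
- by rewrite gtr0_sg // => /esym/eqP; rewrite sgr_cp0 => b0; rewrite gtr0_sg ?addr_gt0.
- by rewrite ltr0_sg // => /esym/eqP; rewrite sgr_cp0 => b0;
    rewrite ltr0_sg // -oppr_gt0 opprD addr_gt0 ?oppr_gt0.
- by move=> /esym/eqP; rewrite sgr_cp0 => /eqP ->; rewrite addr0 sgr0.
Qed.

Lemma sgr_addr_small (R : realType) (a b : R) : a != 0 ->
  exists2 e, 0 < e & forall d, 0 < d -> d <= e -> Num.sg (a + d * b) = Num.sg a.
Proof.
(* This keeps [d * b] below half of [a] in absolute value; the added 1 covers [b = 0]. *)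
move=> a0; exists (`|a| / (2 * (`|b| + 1))).
  by rewrite divr_gt0 ?normr_gt0 // mulr_gt0 // ltr_wpDl.
move=> d d0; rewrite ler_pdivlMr; last by rewrite mulr_gt0 // ltr_wpDl.
have bb : - `|b| <= b <= `|b| by rewrite -ler_norml.
move=> dle; have : - (d * `|b|) <= d * b <= d * `|b|.
  by case/andP: bb => ? ?; rewrite -mulrN !ler_pM2l //; apply/andP.
case/andP=> lo hi; have db := mulr_ge0 (ltW d0) (normr_ge0 b).
case: (ltrgt0P a) a0 dle => // a0 _ dle.
- rewrite [RHS]gtr0_sg // gtr0_sg //; nra.
- rewrite [RHS]ltr0_sg // ltr0_sg //; nra.
Qed.

Section Span.
Variables (R : realType) (n : nat).
Implicit Types (s t : set 'cV[R]_n).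

(** A containing subspace of least dimension is the smallest one, since meeting it with another
    containing subspace cannot lower its dimension. *)
Lemma linear_spanP s : s `<=` [set` linear_span s] /\
  forall W : {vspace 'cV[R]_n}, s `<=` [set` W] -> (linear_span s <= W)%VS.
Proof.
rewrite /linear_span; set Q := (X in xget _ X); apply: (@xgetPex _ _ Q).
pose P d := `[< exists2 U : {vspace 'cV[R]_n}, s `<=` [set` U] & \dim U = d >].
have exP : exists d, P d by exists (\dim {:'cV[R]_n}); apply/asboolP;
  exists fullv => // x _; rewrite /= memvf.
case: (ex_minnP exP) => d /asboolP[U sU dU] dmin.
exists U; split=> // W sW; apply/capv_idPl/eqP.
rewrite eqEdim capvSl /= dU; apply/dmin/asboolP; exists (U :&: W)%VS => // x sx.
by rewrite /= memv_cap; apply/andP; split; [exact: sU|exact: sW].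
Qed.

Lemma mem_linear_span s x : s x -> x \in linear_span s.
Proof. by have [+ _] := linear_spanP s; apply. Qed.

Lemma linear_span_sub s (W : {vspace 'cV[R]_n}) :
  (forall x, s x -> x \in W) -> (linear_span s <= W)%VS.
Proof. by have [_] := linear_spanP s; apply. Qed.

Lemma cone_dim_le s : (cone_dim s <= n)%N.
Proof.
by rewrite (leq_trans (dimvS (subvf _))) // dimvf /dim /= muln1.
Qed.

Lemma cone_dim_setT : cone_dim [set: 'cV[R]_n] = n.
Proof.
rewrite /cone_dim (_ : linear_span _ = fullv) ?dimvf /dim /= ?muln1 //.
by apply/eqP; rewrite eqEsubv subvf; apply/subvP=> x _; exact: mem_linear_span.
Qed.

Lemma eq_cone_dim s t : s `<=` t -> (forall x, t x -> x \in linear_span s) ->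
  cone_dim s = cone_dim t.
Proof.
move=> st ts; congr (\dim _); apply/eqP; rewrite eqEsubv.
rewrite !linear_span_sub // => x sx; exact/mem_linear_span/st.
Qed.

Lemma pairing_kernel (w : 'rV[R]_n) :
  exists K : {vspace 'cV[R]_n}, forall z, (z \in K) = (pairing w z == 0).
Proof.
exists (lker (linfun (mulmx w : 'cV[R]_n -> 'M[R]_1))) => z.
rewrite memv_ker lfunE /=; apply/eqP/eqP => [h|]; first by rewrite /pairing h mxE.
by move=> h; apply/matrixP=> i j; rewrite !ord1 [RHS]mxE.
Qed.

End Span.

Section OpenCones.
Variables (R : realType) (n : nat).
Implicit Types (C : set 'cV[R]_n) (w : 'rV[R]_n).

(* A convex cone that is open in its linear span. *)
Definition open_cone C := [/\ forall x y, C x -> C y -> C (x + y),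
  forall a x, 0 < a -> C x -> C (a *: x)
  & forall x y, C x -> C y -> exists2 e, 0 < e & C (x - e *: y)].

Definition sgset w (e : R) : set 'cV[R]_n := [set x | Num.sg (pairing w x) = e].

Lemma open_coneT : open_cone setT.
Proof. by split=> // x y _ _; exists 1. Qed.

Lemma open_cone_sg C w e : open_cone C -> open_cone (C `&` sgset w e).
Proof.
case=> CD CZ CB; split.
- move=> x y [Cx wx] [Cy wy]; split; first exact: CD.
  by rewrite /sgset /= pairingDr sgr_addr // wx wy.
- move=> a x a0 [Cx wx]; split; first exact: CZ.
  by rewrite /sgset /= pairingZr sgrM wx gtr0_sg // mul1r.
move=> x y [Cx wx] [Cy wy]; have [d d0 Cd] := CB _ _ Cx Cy.
(* [CB] gives one admissible step [d]; convexity gives all shorter ones, which leaves room to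
   preserve the sign of [w] as well. *)
have Cs t : 0 < t -> t < d -> C (x - t *: y).
  move=> t0 td; have -> : x - t *: y = (1 - t / d) *: x + (t / d) *: (x - d *: y).
    rewrite scalerBr scalerBl scale1r scalerA divfK ?gt_eqF //.
    by rewrite addrA subrK.
  apply: CD; apply: CZ => //; last by rewrite divr_gt0.
  by rewrite subr_gt0 ltr_pdivrMr // mul1r.
have [w0|w0] := eqVneq (pairing w x) 0.
  exists (d / 2); first by rewrite divr_gt0.
  split.
    by apply: Cs; rewrite ?divr_gt0 // ltr_pdivrMr // mulr_natr mulr2n ltr_pwDl.
  move: wx wy; rewrite /sgset /= pairingBr pairingZr w0 sgr0 => <- /eqP.
  by rewrite sgr_eq0 => /eqP ->; rewrite mulr0 subr0 sgr0.
have [d' d'0 Hd'] := sgr_addr_small (- pairing w y) w0.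
exists (Num.min (d / 2) d'); first by rewrite lt_min d'0 divr_gt0.
have m0 : 0 < Num.min (d / 2) d' by rewrite lt_min d'0 divr_gt0.
split.
  by apply: Cs => //; rewrite gt_min ltr_pdivrMr // mulr_natr mulr2n ltr_pwDl.
by rewrite /sgset /= pairingBr pairingZr -mulrN Hd' // ge_min lexx orbT.
Qed.

Lemma cone_dim_sg C w e : open_cone C -> e != 0 -> C `&` sgset w e !=set0 ->
  cone_dim (C `&` sgset w e) = cone_dim C.
Proof.
case=> CD CZ CB e0 [x [Cx wx]]; apply: eq_cone_dim => [y []//|y Cy].
have w0 : pairing w x != 0 by rewrite -sgr_eq0 wx.
have [d d0 Hd] := sgr_addr_small (pairing w y) w0.
have -> : y = d^-1 *: ((x + d *: y) - x).
  by rewrite addrC addKr scalerA mulVf ?gt_eqF // scale1r.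
apply/memvZ/memvB; apply: mem_linear_span; split=> //.
  by apply: CD => //; exact: CZ.
by rewrite /sgset /= pairingDr pairingZr Hd.
Qed.

(** Balancing points on opposite sides lands on the wall, so the wall and [y] together span [C],
    while the span of the wall alone misses [x]. *)
Lemma cone_dim_sg0 C w x y : open_cone C -> C x -> C y ->
  0 < pairing w x -> pairing w y < 0 ->
  C `&` sgset w 0 !=set0 /\ cone_dim C = (cone_dim (C `&` sgset w 0)).+1.
Proof.
case=> CD CZ CB Cx Cy wx wy.
have bal z t : C z -> C t -> 0 < pairing w z -> pairing w t < 0 ->
    (C `&` sgset w 0) (z + (pairing w z / - pairing w t) *: t).
  move=> Cz Ct wz wt; split.
    by apply/CD/CZ => //; rewrite divr_gt0 // oppr_gt0.
  rewrite /sgset /= pairingDr pairingZr invrN mulrN mulNr divfK ?subrr ?sgr0 //.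
  by rewrite lt_eqF.
split; first by exists (x + (pairing w x / - pairing w y) *: y); exact: bal.
apply/eqP; rewrite eqn_leq; apply/andP; split.
  have : (linear_span C <= linear_span (C `&` sgset w 0) + <[y]>)%VS.
    have mem0 z : (C `&` sgset w 0) z -> z \in (linear_span (C `&` sgset w 0) + <[y]>)%VS.
      by move=> /mem_linear_span; apply/subvP; rewrite addvSl.
    have memy a : a *: y \in (linear_span (C `&` sgset w 0) + <[y]>)%VS.
      by apply: memvZ; apply: (subvP (addvSr _ _)); rewrite memv_line.
    have mempos z : C z -> 0 < pairing w z ->
        z \in (linear_span (C `&` sgset w 0) + <[y]>)%VS.
      move=> Cz wz; rewrite -(addrK ((pairing w z / - pairing w y) *: y) z).
      by apply: memvB => //; apply/mem0/bal.
    apply: linear_span_sub => z Cz.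
    have [wz|wz|wz] := ltrgt0P (pairing w z).
    + exact: mempos.
    (* A point on the negative side is balanced against [x], already known to lie in the span. *)
    + have := mempos _ Cx wx; have := mem0 _ (bal _ _ Cx Cz wx wz).
      set a := _ / _ => h1 h2.
      have a0 : a != 0 by rewrite gt_eqF // divr_gt0 // oppr_gt0.
      rewrite (_ : z = a^-1 *: ((x + a *: z) - x)).
        by apply/memvZ/memvB.
      by rewrite addrC addKr scalerA mulVf // scale1r.
    + by apply: mem0; split=> //; rewrite /sgset /= wz sgr0.
  move=> /dimvS /leq_trans; apply.
  apply: leq_trans (dimv_add_leqif _ _) _; rewrite dim_vline.
  by case: (y != 0); rewrite ?addn0 ?addn1 ?leqnSn.
have [K KE] := pairing_kernel w.
have sub0 : (linear_span (C `&` sgset w 0) <= linear_span C :&: K)%VS.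
  apply: linear_span_sub => z [Cz /eqP]; rewrite sgr_eq0 => wz.
  by rewrite memv_cap mem_linear_span //= KE.
apply: leq_ltn_trans (dimvS sub0) _.
rewrite /cone_dim ltn_neqAle dimvS ?capvSl // andbT.
have [_ ->] := dimv_leqif_eq (capvSl (linear_span C) K).
apply/eqP => /capv_idPl /subvP /(_ x (mem_linear_span Cx)).
by rewrite KE gt_eqF.
Qed.

(** For an open cone, which is homeomorphic to a vector space of its dimension, this is the
    compactly supported Euler characteristic. The empty set needs its own case because its span has
    dimension 0. *)
Definition cell_sign C : int :=
  if `[< C !=set0 >] then (-1) ^+ cone_dim C else 0.

Lemma cell_sign0 : cell_sign set0 = 0.
Proof. by rewrite /cell_sign asboolF // => -[]. Qed.

Lemma cell_signE C : C !=set0 -> cell_sign C = (-1) ^+ cone_dim C.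
Proof. by move=> C0; rewrite /cell_sign asboolT. Qed.

(** If [w] takes both signs, the two sides have full dimension and the wall one less, so one side
    cancels the wall. If it takes one strict sign, the wall is empty: stepping from it away from a
    point of that side would reach the other side. Otherwise [C] is the wall. *)
Lemma cell_sign_split C w : open_cone C -> cell_sign C =
  cell_sign (C `&` sgset w 1) + cell_sign (C `&` sgset w 0) +
  cell_sign (C `&` sgset w (-1)).
Proof.
move=> oC; have [CD CZ CB] := oC.
have [P|/nonemptyPn P] := pselect (C `&` sgset w 1 !=set0);
  have [N|/nonemptyPn N] := pselect (C `&` sgset w (-1) !=set0).
- have [x [Cx /eqP]] := P; have [y [Cy /eqP]] := N.
  rewrite !sgr_cp0 => wy wx; have [Z dZ] := cone_dim_sg0 oC Cx Cy wx wy.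
  have d1 : cone_dim (C `&` sgset w 1) = cone_dim C.
    by apply: cone_dim_sg => //; exact: oner_neq0.
  have dN1 : cone_dim (C `&` sgset w (-1)) = cone_dim C.
    by apply: cone_dim_sg => //; rewrite oppr_eq0 oner_eq0.
  have C0 : C !=set0 by exists x.
  rewrite (cell_signE C0) (cell_signE P) (cell_signE N) (cell_signE Z) d1 dN1.
  by rewrite dZ exprS mulN1r addNr add0r.
- have [x [Cx /eqP]] := P; rewrite !sgr_cp0 => wx.
  rewrite N cell_sign0 addr0.
  rewrite (_ : C `&` sgset w 0 = set0) ?cell_sign0 ?addr0; last first.
    rewrite -subset0 => z [Cz /eqP]; rewrite sgr_eq0 => /eqP wz.
    have [e e0 Ce] := CB _ _ Cz Cx.
    suff : (C `&` sgset w (-1)) (z - e *: x) by rewrite N.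
    by split=> //; rewrite /sgset /= pairingBr wz sub0r pairingZr;
      rewrite ltr0_sg // oppr_lt0 mulr_gt0.
  have C0 : C !=set0 by exists x.
  by rewrite (cell_signE C0) (cell_signE P) (cone_dim_sg oC (oner_neq0 R) P).
- have [x [Cx /eqP]] := N; rewrite !sgr_cp0 => wx.
  rewrite P cell_sign0 add0r.
  rewrite (_ : C `&` sgset w 0 = set0) ?cell_sign0 ?add0r; last first.
    rewrite -subset0 => z [Cz /eqP]; rewrite sgr_eq0 => /eqP wz.
    have [e e0 Ce] := CB _ _ Cz Cx.
    suff : (C `&` sgset w 1) (z - e *: x) by rewrite P.
    by split=> //; rewrite /sgset /= pairingBr wz sub0r pairingZr;
      rewrite gtr0_sg // oppr_gt0 pmulr_rlt0.
  have sN0 : -1 != 0 :> R by rewrite oppr_eq0 oner_eq0.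
  have C0 : C !=set0 by exists x.
  by rewrite (cell_signE C0) (cell_signE N) (cone_dim_sg oC sN0 N).
rewrite P N cell_sign0 addr0 add0r; congr cell_sign; apply/esym/setIidPl => x Cx.
rewrite /sgset /=; case: sgrP => // wx.
  have : (C `&` sgset w 1) x by split; rewrite /sgset /= ?gtr0_sg.
  by rewrite P.
have : (C `&` sgset w (-1)) x by split; rewrite /sgset /= ?ltr0_sg.
by rewrite N.
Qed.

End OpenCones.

(** * The combinatorial Euler characteristic *)

Section EulerSum.
Variables (R : realType) (n : nat).
Implicit Types (C : set 'cV[R]_n) (w : 'rV[R]_n) (L : seq 'rV[R]_n)
  (f g : 'cV[R]_n -> int).

Definition signs : seq R := [:: 1; 0; -1].

Lemma uniq_signs : uniq signs.
Proof.
have h : (1 : R) != -1 by rewrite -subr_eq0 opprK -[1 + 1]/(2%:R) pnatr_eq0.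
by rewrite /= !inE negb_or oner_eq0 h eq_sym oppr_eq0 oner_eq0.
Qed.

(* The integral of [f] with respect to the compactly supported Euler
   characteristic, when [f] is constant on the cells into which the hyperplanes
   [L] cut [C]. *)
Fixpoint euler_sum L C f : int :=
  if L is w :: L' then \sum_(e <- signs) euler_sum L' (C `&` sgset w e) f
  else cell_sign C * f (xget 0 C).

Lemma eq_euler_sum L C f g : (forall x, C x -> f x = g x) ->
  euler_sum L C f = euler_sum L C g.
Proof.
elim: L C => [|w L IH] C fg /=.
  have [C0|/nonemptyPn ->] := pselect (C !=set0); last by rewrite cell_sign0 !mul0r.
  by rewrite fg //; case: C0 => x Cx; exact: xgetPex (ex_intro _ x Cx).
by apply: eq_bigr => e _; apply: IH => x [Cx _]; exact: fg.
Qed.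

Lemma euler_sum_set0 L f : euler_sum L set0 f = 0.
Proof.
elim: L => [|w L IH] /=; first by rewrite cell_sign0 mul0r.
by apply: big1 => e _; rewrite set0I.
Qed.

Lemma euler_sum_lin L C I (r : seq I) (k : I -> int) (F : I -> 'cV[R]_n -> int) :
  euler_sum L C (fun x => \sum_(i <- r) k i * F i x) =
  \sum_(i <- r) k i * euler_sum L C (F i).
Proof.
elim: L C => [|w L IH] C /=.
  by rewrite mulr_sumr; apply: eq_bigr => i _; rewrite mulrCA.
under eq_bigr do rewrite IH.
by rewrite exchange_big; apply: eq_bigr => i _; rewrite mulr_sumr.
Qed.

Lemma euler_sum_sum L C I (r : seq I) (F : I -> 'cV[R]_n -> int) :
  euler_sum L C (fun x => \sum_(i <- r) F i x) =
  \sum_(i <- r) euler_sum L C (F i).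
Proof.
have := euler_sum_lin L C r (fun=> 1) F.
under [in RHS]eq_bigr do rewrite mul1r.
by move=> <-; apply: eq_euler_sum => x _; apply: eq_bigr => i _; rewrite mul1r.
Qed.

Lemma euler_sumB L C f g :
  euler_sum L C (fun x => f x - g x) = euler_sum L C f - euler_sum L C g.
Proof.
elim: L C => [|w L IH] C /=; first by rewrite mulrBr.
by rewrite -sumrB; apply: eq_bigr.
Qed.

Lemma euler_sum1 L C : open_cone C -> euler_sum L C (fun=> 1) = cell_sign C.
Proof.
elim: L C => [|w L IH] C oC /=; first by rewrite mulr1.
rewrite !big_cons big_nil addr0 addrA (cell_sign_split w oC).
by rewrite !IH //; exact: open_cone_sg.
Qed.

Lemma sgset_disj w e e' : e != e' -> sgset w e `&` sgset w e' = set0.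
Proof.
by move=> ee; rewrite -subset0 => x [xe xe']; rewrite -xe -xe' eqxx in ee.
Qed.

(* The order of the hyperplanes does not matter: [w] may be used first. *)
Lemma euler_sum_mem L C f w : w \in L ->
  euler_sum L C f = \sum_(e <- signs) euler_sum L (C `&` sgset w e) f.
Proof.
elim: L C => // w' L IH C; rewrite inE => /predU1P[<-|wL] /=.
  rewrite [LHS]big_seq [RHS]big_seq; apply: eq_bigr => e es.
  rewrite (bigD1_seq e) ?uniq_signs //= -setIA setIid big1 ?addr0 // => e' ee'.
  by rewrite -setIA sgset_disj 1?eq_sym // setI0 euler_sum_set0.
rewrite exchange_big; apply: eq_bigr => e' _; rewrite IH //.
by apply: eq_bigr => e _; rewrite setIAC.
Qed.

Definition cell (S : seq ('rV[R]_n * R)) : set 'cV[R]_n :=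
  [set x | forall p, p \in S -> sgset p.1 p.2 x].

Lemma cell_cons p S : cell (p :: S) = sgset p.1 p.2 `&` cell S.
Proof.
apply/seteqP; split=> x.
  by move=> h; split=> [|q qS]; apply: h; rewrite inE ?eqxx // qS orbT.
by case=> hp hS q; rewrite inE => /predU1P[->|/hS].
Qed.

(** By [euler_sum_mem] the hyperplanes of [S] may be cut first; only the prescribed signs survive,
    and the remaining cuts are absorbed by [euler_sum1]. *)
Lemma euler_sum_cell L C S : open_cone C ->
  (forall p, p \in S -> p.1 \in L /\ p.2 \in signs) ->
  euler_sum L C (fun x => (x \in cell S)%:R) = cell_sign (C `&` cell S).
Proof.
elim: S C => [|p S IH] C oC SL.
  have -> : cell [::] = setT by rewrite -subTset => x _ p.
  rewrite setIT -(euler_sum1 L oC); apply: eq_euler_sum => x _.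
  by rewrite in_setT.
have [pL ps] := SL _ (mem_head _ _).
rewrite (euler_sum_mem _ _ pL) (bigD1_seq p.2) ?uniq_signs //=.
rewrite [X in _ + X]big1 ?addr0 => [|e ep].
  rewrite cell_cons setIA -IH.
  - apply: eq_euler_sum => x [_ px]; congr (_%:R); congr (nat_of_bool _).
    by apply/idP/idP; rewrite !inE => // -[].
  - exact: open_cone_sg.
  - by move=> q qS; apply: SL; rewrite inE qS orbT.
(* The indicator vanishes on the other signs; zero is written as 1 - 1 to apply [euler_sumB]. *)
rewrite -(subrr (euler_sum L (C `&` sgset p.1 e) (fun=> 1))) -euler_sumB.
apply: eq_euler_sum => x [_ xe]; rewrite subrr memNset // cell_cons => -[xp _].
by have := sgset_disj p.1 ep; rewrite -subset0 => /(_ x); apply.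
Qed.

Lemma open_cone_cell S : open_cone (cell S).
Proof.
elim: S => [|p S IH]; last by rewrite cell_cons setIC; exact: open_cone_sg.
have -> : cell [::] = setT by rewrite -subTset => x _ p.
exact: open_coneT.
Qed.

End EulerSum.

(** * Matroids *)

Section Matroids.
(* Undoes the shadowing of the [finset] lemmas by those on classical sets. *)
Import mathcomp.boot.fintype mathcomp.boot.finset.
Variables (G : finType) (M : matroid G).
Implicit Types (A B I X : {set G}).
Local Open Scope set_scope.

Lemma mrank_indep A : indep M A -> mrank M A = #|A|.
Proof.
move=> iA; apply/eqP; rewrite eqn_leq; apply/andP; split.
  by apply/bigmax_leqP => I /andP[_ /subset_leq_card].
by apply: leq_bigmax_cond; rewrite iA subxx.
Qed.

Lemma mspan_indep A x : indep M A ->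
  (x \in mspan M A) = (x \in A) || ~~ indep M (x |: A).
Proof.
move=> iA; rewrite inE (mrank_indep iA).
have [xA|xA] := boolP (x \in A).
  by rewrite (setUidPr _) ?sub1set // mrank_indep // eqxx.
have [ix|ix] /= := boolP (indep M (x |: A)).
  by rewrite mrank_indep // cardsU1 xA gtn_eqF.
rewrite eqn_leq; apply/andP; split; last first.
  by apply: leq_bigmax_cond; rewrite iA subsetUr.
apply/bigmax_leqP => I /andP[iI IA]; rewrite leqNgt; apply: contra ix => lt.
suff <- : I = x |: A by [].
by apply/eqP; rewrite eqEcard IA cardsU1 xA.
Qed.

(** A larger independent subset of [X] would augment [A] by an element of its span. *)
Lemma mrank_sandwich A X : indep M A -> A \subset X -> X \subset mspan M A ->
  mrank M X = #|A|.
Proof.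
move=> iA AX XA; apply/eqP; rewrite eqn_leq; apply/andP; split; last first.
  by apply: leq_bigmax_cond; rewrite iA.
apply/bigmax_leqP => I /andP[iI IX]; rewrite leqNgt; apply/negP => lt.
have [y] := indep_aug iA iI lt; rewrite inE => /andP[yA yI] iy.
have := subsetP XA _ (subsetP IX _ yI).
by rewrite mspan_indep // (negPf yA) iy.
Qed.

Lemma mbasis_indep B : mbasis M B -> indep M B.
Proof. by case/maxsetP. Qed.

Lemma mbasis_span B x : mbasis M B -> x \in mspan M B.
Proof.
move=> bB; rewrite (mspan_indep _ (mbasis_indep bB)) -implyNb; apply/implyP => xB.
apply: contra xB => ix; case/maxsetP: bB => _ /(_ _ ix (subsetUr _ _)) <-.
by rewrite setU11.
Qed.

(** Repeated augmentation from [B]; maximality of [B] excludes an independent set larger than it. *)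
Lemma indep_extend B I : mbasis M B -> indep M I ->
  exists I', [/\ indep M I', I \subset I', I' \subset I :|: B & #|I'| = #|B|].
Proof.
move=> bB; have [k] := ubnP (#|B| - #|I|); elim: k I => // k IH I lek iI.
have [lt|] := ltnP #|I| #|B|.
  have [y] := indep_aug iI (mbasis_indep bB) lt.
  rewrite inE => /andP[yI yB] iy.
  have [|I' [iI' sI' sB cI']] := IH (y |: I) _ iy.
    by rewrite cardsU1 yI; lia.
  exists I'; split=> //; first exact: subset_trans (subsetUr _ _) sI'.
  apply: subset_trans sB _; rewrite -setUA subUset subxx andbT.
  by rewrite sub1set inE yB orbT.
rewrite leq_eqVlt => /predU1P[eqc|lt]; first by exists I; rewrite subxx subsetUl.
have [y] := indep_aug (mbasis_indep bB) iI lt.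
rewrite inE => /andP[yB _] iy.
case/maxsetP: bB => _ /(_ _ iy (subsetUr _ _)) eB.
by rewrite -eB setU11 in yB.
Qed.

(* Extending [x] together with the intersection by elements of [B] to a basis
   misses exactly one element of [B], which cannot lie in both [A] and [A']. *)
Lemma mspanI B A A' x : mbasis M B -> A \subset B -> A' \subset B ->
  x \in mspan M A -> x \in mspan M A' -> x \in mspan M (A :&: A').
Proof.
move=> bB AB A'B; have iB := mbasis_indep bB.
have iS (C : {set G}) : C \subset B -> indep M C by move/indep_sub; apply.
have IB : A :&: A' \subset B by exact: subset_trans (subsetIl _ _) AB.
rewrite (mspan_indep _ (iS _ AB)) (mspan_indep _ (iS _ A'B)) (mspan_indep _ (iS _ IB)).
have [xB|xB] := boolP (x \in B).
  have ix (C : {set G}) : C \subset B -> indep M (x |: C).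
    by move=> CB; apply: iS; rewrite subUset sub1set xB.
  by rewrite !ix //= !orbF inE => -> ->.
have xC (C : {set G}) : C \subset B -> (x \in C) = false.
  by move=> CB; apply/negbTE; apply: contra xB; exact: (subsetP CB).
rewrite !xC //= => dA dA'; apply/negP => iI.
have [I' [iI' sI' sIB cI']] := indep_extend bB iI.
have xI' : x \in I' by apply: (subsetP sI'); rewrite setU11.
have cD : #|B :\: I'| = 1%N.
  have : #|I'| = (#|B :&: I'| + 1)%N.
    rewrite (cardsD1 x) xI' addnC; congr (_ + _)%N.
    apply: eq_card => y; rewrite !inE.
    have [->|yx] /= := eqVneq y x; first by rewrite (negPf xB).
    have [yI'|] := boolP (y \in I'); last by rewrite andbF.
    have := subsetP sIB _ yI'; rewrite !inE (negPf yx) /= andbT.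
    case/orP => [/andP[yA _]|->//].
    by rewrite (subsetP AB).
  by rewrite cI' -{1}(cardsID I' B) => /addnI.
have miss (C : {set G}) : C \subset B -> ~~ indep M (x |: C) ->
    exists2 y, y \in C & y \notin I'.
  move=> CB dC; apply/subsetPn; apply: contra dC => CI'.
  by apply: indep_sub iI'; rewrite subUset sub1set xI'.
have [y yA yI'] := miss _ AB dA; have [z zA' zI'] := miss _ A'B dA'.
have /eqP/cards1P[t Et] := cD.
have yt : y \in [set t] by rewrite -Et inE yI' (subsetP AB).
have zt : z \in [set t] by rewrite -Et inE zI' (subsetP A'B).
have yz : y = z by rewrite (set1P yt) (set1P zt).
by case/negP: yI'; apply: (subsetP sI'); rewrite !inE yA yz zA' orbT.
Qed.

Section Basis.
Variables (r : nat) (b : 'I_r -> G).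
Hypotheses (binj : injective b) (bB : mbasis M [set b j | j : 'I_r]).
Implicit Types J K : {set 'I_r}.

Lemma indep_basis_imset J : indep M (b @: J).
Proof. by apply: indep_sub (mbasis_indep bB); apply: imsetS; apply/subsetP. Qed.

Lemma mspan_basis_mono J K : J \subset K -> mspan M (b @: J) \subset mspan M (b @: K).
Proof.
move=> JK; have bJK : b @: J \subset b @: K by exact: imsetS.
apply/subsetP => x; rewrite !mspan_indep ?indep_basis_imset //.
case/orP => [/(subsetP bJK) ->//|dx]; apply/orP; right; apply: contra dx.
by apply: indep_sub; exact: setUS.
Qed.

(** For [x] outside the basis, this indexes the rest of its fundamental circuit; for [b j] it is
    [{j}]. *)
Definition basis_support x : {set 'I_r} :=
  \bigcap_(J : {set 'I_r} | x \in mspan M (b @: J)) J.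

(** The index sets whose span contains [x] are closed under intersection by [mspanI], so a least one
    exists. Membership in intersections of flats thus becomes inclusion of index sets. *)
Lemma basis_supportP x J : (x \in mspan M (b @: J)) = (basis_support x \subset J).
Proof.
apply/idP/idP => [xJ|/mspan_basis_mono/subsetP]; first exact: bigcap_inf.
apply; rewrite /basis_support; elim/big_ind: _ => [|K L xK xL|//].
  suff <- : [set b j | j : 'I_r] = b @: setT by exact: mbasis_span.
  by apply/setP=> y; apply/imsetP/imsetP => -[j _ ->]; exists j.
rewrite imsetI; last by move=> ? ? _ _; exact: binj.
by apply: (mspanI bB) => //; apply: imsetS; apply/subsetP.
Qed.

Lemma basis_support_basis j : basis_support (b j) \subset [set j].
Proof. by rewrite -basis_supportP mspan_indep ?indep_basis_imset // imset_f ?inE. Qed.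

Lemma mrank_basis_sandwich J X : b @: J \subset X ->
  (forall x, x \in X -> basis_support x \subset J) -> mrank M X = #|J|.
Proof.
move=> JX XJ; rewrite (mrank_sandwich (indep_basis_imset J)) ?card_imset //.
by apply/subsetP => x /XJ; rewrite basis_supportP.
Qed.

End Basis.
End Matroids.

(** * Relative interiors of cones *)

Section RelativeInterior.
Variables (R : realType) (n : nat).
Implicit Types (s : set 'cV[R]_n) (x y : 'cV[R]_n) (w : 'rV[R]_n)
  (A : seq 'rV[R]_n).

Definition halfspaces A s := forall y, s y <-> {in A, forall a, 0 <= pairing a y}.

Lemma rational_coneP s : rational_cone s -> exists k (v : 'I_k -> 'cV[int]_n),
  forall y, s y <->
    exists2 c : 'I_k -> R, forall i, 0 <= c i & y = \sum_i c i *: latR R (v i).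
Proof.
case=> k [v ->]; exists k, v => y; split; first by case=> c c0 <-; exists c.
by case=> c c0 ->; exists c.
Qed.

Lemma rational_cone_halfspaces s : rational_cone s -> exists A, halfspaces A s.
Proof.
case/rational_coneP => k [v sv].
have [A HA] := cone_halfspaces (fun i => latR R (v i)).
by exists A => y; rewrite sv; exact: HA.
Qed.

Lemma halfspacesD A s x y : halfspaces A s -> s x -> s y -> s (x + y).
Proof.
move=> HA /HA xA /HA yA; apply/HA => a aA.
by rewrite pairingDr addr_ge0 ?xA ?yA.
Qed.

Lemma halfspacesZ A s a x : halfspaces A s -> 0 <= a -> s x -> s (a *: x).
Proof.
by move=> HA a0 /HA xA; apply/HA => b bA; rewrite pairingZr mulr_ge0 ?xA.
Qed.

(** Inequalities tight at [x] are tight at [y] and stay tight; the others, finitely many, have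
    slack. *)
Lemma halfspaces_sub_small A s x y : halfspaces A s -> s x -> s y ->
  (forall a, a \in A -> pairing a x = 0 -> pairing a y = 0) ->
  exists2 e, 0 < e & s (x - e *: y).
Proof.
move=> HA /HA xA /HA yA zA; suff [e e0 He] : exists2 e, 0 < e &
    forall a, a \in A -> 0 <= pairing a (x - e *: y) by exists e => //; exact/HA.
elim: A xA yA zA {HA} => [|a A IH] xA yA zA; first by exists 1.
have sub (P : 'rV[R]_n -> Prop) : {in a :: A, forall b, P b} -> {in A, forall b, P b}.
  by move=> h b bA; apply: h; rewrite inE bA orbT.
have [e e0 He] := IH (sub _ xA) (sub _ yA) (sub _ zA).
have xa := xA _ (mem_head _ _); have ya := yA _ (mem_head _ _).
have za := zA _ (mem_head _ _).
(* The ratio is the step at which [a] becomes tight; it never does if [pairing a y] is 0. *)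
pose d := if pairing a y == 0 then e else Num.min e (pairing a x / pairing a y).
have d0 : 0 < d.
  rewrite /d; case: eqP => // /eqP y0.
  rewrite lt_min e0 divr_gt0 // lt_def ?xa ?ya ?andbT //.
  by apply: contra y0 => /eqP/za ->.
have de : d <= e by rewrite /d; case: eqP => // _; rewrite ge_min lexx.
exists d => // b; rewrite inE => /predU1P[->|bA].
  rewrite pairingBr pairingZr subr_ge0 /d; case: eqP => [->|/eqP y0]; first by rewrite mulr0.
  by rewrite -ler_pdivlMr ?ge_min ?lexx ?orbT // lt_def y0.
apply: le_trans (He _ bA) _; rewrite !pairingBr !pairingZr lerB // ler_wpM2r //.
exact: (sub _ yA).
Qed.

(** No proper face of [s] contains [x]; the form with supporting functionals matches [face] and
    avoids topology. *)
Definition relint s : set 'cV[R]_n := [set x | s x /\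
  forall w, (forall y, s y -> 0 <= pairing w y) -> pairing w x = 0 ->
    forall y, s y -> pairing w y = 0].

Lemma relintD A s x y : halfspaces A s -> relint s x -> s y -> relint s (x + y).
Proof.
move=> HA [sx xw] sy; split; first exact: halfspacesD HA sx sy.
move=> w w0 wxy; apply: xw => //; apply/eqP; rewrite eq_le w0 // andbT.
by rewrite -wxy pairingDr lerDl w0.
Qed.

Lemma relint_neq0 s : rational_cone s -> relint s !=set0.
Proof.
move=> /rational_coneP[k [v sv]].
have svi i : s (latR R (v i)).
  apply/sv; exists (fun j => (j == i)%:R) => [j|]; first exact: ler0n.
  rewrite (bigD1 i) //= eqxx scale1r big1 ?addr0 // => j /negPf ->.
  by rewrite scale0r.
exists (\sum_i latR R (v i)); split.
  by apply/sv; exists (fun=> 1) => //; apply: eq_bigr => i _; rewrite scale1r.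
move=> w w0; rewrite pairing_sumr => /eqP.
rewrite psumr_eq0 => [/allP wv|i _]; last exact: w0.
move=> _ /sv[c _ ->]; rewrite pairing_sumr big1 // => i _.
rewrite pairingZr; have /implyP/(_ isT)/eqP -> := wv i (mem_index_enum i).
by rewrite mulr0.
Qed.

Lemma cone_dim_relint s : rational_cone s -> cone_dim (relint s) = cone_dim s.
Proof.
move=> rs; have [A HA] := rational_cone_halfspaces rs.
have [x rx] := relint_neq0 rs; apply: eq_cone_dim => [y []//|y sy].
rewrite (_ : y = (x + y) - x); last by rewrite addrC addKr.
by apply: memvB; apply: mem_linear_span => //; exact: relintD HA rx sy.
Qed.

Definition relint_signs A s : seq ('rV[R]_n * R) :=
  [seq (a, if `[< forall y, s y -> pairing a y = 0 >] then 0 else 1) | a <- A].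

(** Inequalities vanishing on all of [s] become equations, the others strict. Conversely, these
    signs leave room to step from [x] against any [y] in [s], so a functional nonnegative on [s] and
    zero at [x] cannot be positive at [y]. *)
Lemma relint_cell A s : halfspaces A s -> relint s = cell (relint_signs A s).
Proof.
move=> HA; apply/seteqP; split=> x.
  case=> sx xw _ /mapP[a aA ->]; rewrite /sgset /=.
  have a0 y : s y -> 0 <= pairing a y by move=> /HA; apply.
  case: asboolP => [->|na]; rewrite ?sgr0 // gtr0_sg // lt_def a0 // andbT.
  by apply/eqP => ax; apply: na; exact: xw.
move=> xc; have xA a : a \in A ->
    Num.sg (pairing a x) = if `[< forall y, s y -> pairing a y = 0 >] then 0 else 1.
  by move=> aA; apply: (xc (a, _)); apply/mapP; exists a.
have sx : s x.
  apply/HA => a /xA; case: ifP => _ /eqP; rewrite sgr_cp0; first by move/eqP ->.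
  exact: ltW.
split=> // w w0 wx y sy; apply/eqP; rewrite eq_le w0 // andbT.
have [|e e0 se] := halfspaces_sub_small HA sx sy.
  move=> a aA ax; have := xA _ aA; rewrite ax sgr0.
  by case: asboolP => [->//|_] /esym/eqP; rewrite oner_eq0.
have := w0 _ se; rewrite pairingBr wx sub0r pairingZr oppr_ge0.
by rewrite pmulr_rle0.
Qed.

(** The integrand is the indicator of [relint s] minus that of its part with [w] negative, which is
    either empty or of the same dimension. *)
Lemma euler_sum_relint L A s w : rational_cone s -> halfspaces A s ->
  {subset A <= L} -> w \in L ->
  euler_sum L setT (fun x => (x \in relint s)%:R * (0 <= pairing w x)%R%:R) =
  (-1) ^+ cone_dim s * (`[< forall y, s y -> 0 <= pairing w y >])%R%:R.
Proof.
move=> rs HA AL wL; have Ec := relint_cell HA.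
pose S := relint_signs A s; pose S' := (w, -1) :: S.
have SL p : p \in S -> p.1 \in L /\ p.2 \in signs R.
  case/mapP => a /AL aL -> /=; split=> //.
  by case: ifP => _; rewrite !inE eqxx ?orbT.
have S'L p : p \in S' -> p.1 \in L /\ p.2 \in signs R.
  by rewrite inE => /predU1P[->/=|/SL//]; rewrite wL !inE eqxx !orbT.
rewrite (@eq_euler_sum _ _ _ _ _ (fun x => (x \in cell S)%:R - (x \in cell S')%:R));
  last first.
  move=> x _; rewrite cell_cons Ec in_setI -/S.
  have -> : (x \in sgset w (-1)) = (pairing w x < 0).
    by apply/idP/idP; rewrite inE /sgset /=; [move/eqP|move=> h; apply/eqP];
      rewrite sgr_cp0.
  by case: (x \in cell S); case: ltP; rewrite ?mul0r ?mulr0 ?mulr1 ?subr0 ?subrr.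
rewrite euler_sumB !euler_sum_cell //; try exact: open_coneT.
rewrite !setTI cell_cons -Ec setIC /=.
have [x rx] := relint_neq0 rs; rewrite (cell_signE (ex_intro _ x rx)).
rewrite cone_dim_relint //; case: asboolP => [w0|/existsNP[y /not_implyP[sy /negP]]].
  rewrite (_ : _ `&` _ = set0) ?cell_sign0 ?subr0 ?mulr1 //.
  rewrite -subset0 => z [[sz _] /eqP]; rewrite sgr_cp0.
  by apply/negP; rewrite -leNgt w0.
rewrite -ltNge => wy; have oc : open_cone (relint s).
  by rewrite Ec; exact: open_cone_cell.
have N : relint s `&` sgset w (-1) !=set0.
  (* Moving by [t *: y] lowers [w] by its absolute value at [x] plus 1, hence below zero. *)
  pose t := (`|pairing w x| + 1) / - pairing w y.
  have t0 : 0 <= t by rewrite divr_ge0 ?addr_ge0 // oppr_ge0 ltW.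
  exists (x + t *: y); split.
    by apply: (relintD HA) => //; exact: (halfspacesZ HA).
  rewrite /sgset /=; apply/eqP; rewrite sgr_cp0 pairingDr pairingZr.
  rewrite /t invrN mulrN mulNr divfK ?lt_eqF // subr_lt0.
  by rewrite ltr_pwDr // ler_norm.
rewrite cell_signE // cone_dim_sg // ?oppr_eq0 ?oner_eq0 //.
by rewrite cone_dim_relint // subrr mulr0.
Qed.

End RelativeInterior.

(** * Fans *)

(** Descent on the sum of the absolute values of the entries, which drops when a non-unit is
    factored out. The sign of the factor moves into [w'] to keep the multiplier positive. *)
Lemma primitive_multiple n (v : 'cV[int]_n) : v != 0 ->
  exists (p : 'cV[int]_n) (m : int), [/\ 0 < m, v = m *: p & primitive p].
Proof.
pose N (v : 'cV[int]_n) := (\sum_i `|v i ord0|)%N.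
have NZ k w : N (k *: w) = (`|k| * N w)%N.
  by rewrite /N big_distrr; apply: eq_bigr => i _; rewrite mxE abszM.
have N0 w : w != 0 -> (0 < N w)%N.
  apply: contraTT; rewrite -leqNgt leqn0 sum_nat_eq0 => /forallP w0.
  apply/negPn/eqP/colP => i; rewrite mxE; apply/eqP.
  by rewrite -absz_eq0; exact: (implyP (w0 i)).
have [d] := ubnP (N v); elim: d v => // d IH v lt v0.
have [pv|/existsNP[k /existsNP[w /not_implyP[vE /eqP k1]]]] := pselect (primitive v).
  by exists v, 1; rewrite scale1r.
have k0 : k != 0 by apply: contra v0 => /eqP k0; rewrite vE k0 scale0r.
have w0 : w != 0 by apply: contra v0 => /eqP w0; rewrite vE w0 scaler0.
pose w' := Num.sg k *: w.
have vE' : v = `|k| *: w' by rewrite scalerA mulrC -numEsg.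
have w'0 : w' != 0 by apply: contra v0 => /eqP w'0; rewrite vE' w'0 scaler0.
have [|p [m [m0 w'E pp]]] := IH w' _ w'0.
  have := N0 _ w'0; rewrite vE' NZ in lt => Nw'.
  have k2 : (1 < `| `|k| |)%N by move: k1 k0; clear; lia.
  by rewrite -ltnS (leq_trans _ lt) // ltnS ltn_Pmull.
exists p, (`|k| * m); split=> //; first by rewrite mulr_gt0 ?normr_gt0.
by rewrite vE' w'E scalerA.
Qed.

Section FanGeometry.
Variables (R : realType) (n : nat).
Implicit Types (s t : set 'cV[R]_n) (x y : 'cV[R]_n) (w : 'rV[R]_n).

Lemma pairing_linear_span0 s w : (forall y, s y -> pairing w y = 0) ->
  forall y, y \in linear_span s -> pairing w y = 0.
Proof.
move=> w0; have [K KE] := pairing_kernel w.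
have /subvP sK : (linear_span s <= K)%VS.
  by apply: linear_span_sub => y /w0 wy; rewrite KE wy.
by move=> y /sK; rewrite KE => /eqP.
Qed.

Lemma cone_dim_ray (p : 'cV[R]_n) : p != 0 ->
  cone_dim [set c *: p | c in [set c : R | 0 <= c]] = 1%N.
Proof.
move=> p0; rewrite /cone_dim (_ : linear_span _ = <[p]>%VS) ?dim_vline ?p0 //.
apply/eqP; rewrite eqEsubv; apply/andP; split.
  by apply: linear_span_sub => _ [c _ <-]; rewrite memvZ ?memv_line.
rewrite -memvE; apply: mem_linear_span; exists 1; last by rewrite scale1r.
exact: ler01.
Qed.

Variable Sigma : fan R n.

Lemma fan_ray_gen rho : rho \in cones Sigma -> cone_dim rho = 1%N ->
  rho = [set c *: latR R (ray_gen rho) | c in [set c : R | 0 <= c]].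
Proof.
move=> rhoS d1; rewrite /ray_gen.
set Q := (X in xget _ X); apply: (proj2 (_ : Q (xget 0 Q))).
apply: (@xgetPex _ _ Q); have [rrho crho] := fan_cone rhoS.
have [k [v sv]] := rational_coneP rrho; have [A HA] := rational_cone_halfspaces rrho.
have [i vi0] : exists i, latR R (v i) != 0.
  apply: contrapT => /forallNP v0.
  suff : (cone_dim rho <= \dim (0 : {vspace 'cV[R]_n}))%N by rewrite d1 dimv0.
  apply/dimvS/linear_span_sub => _ /sv[c _ ->]; rewrite memv0 big1 // => i _.
  by have /negP/negPn/eqP -> := v0 i; rewrite scaler0.
have [|p [m [m0 vE pp]]] := @primitive_multiple _ (v i).
  by apply: contra vi0 => /eqP ->; rewrite /latR map_mx0.
have m0R : 0 < m%:~R :> R by rewrite ltr0z.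
have {}vE : latR R (v i) = m%:~R *: latR R p by rewrite vE /latR map_mxZ.
have rp c : 0 <= c -> rho (c *: latR R p).
  move=> c0; have -> : c *: latR R p = (c / m%:~R) *: latR R (v i).
    by rewrite vE scalerA divfK // gt_eqF.
  apply: (halfspacesZ HA); first by rewrite divr_ge0 // ltW.
  apply/sv; exists (fun j => (j == i)%:R) => [j|]; first exact: ler0n.
  rewrite (bigD1 i) //= eqxx scale1r big1 ?addr0 // => j /negPf ->.
  by rewrite scale0r.
exists p; split=> //; apply/seteqP; split=> [x rx|_ [c c0 <-]]; last exact: rp.
have p0 : latR R p != 0 by apply: contra vi0 => /eqP p0; rewrite vE p0 scaler0.
have : x \in <[latR R p]>%VS.
  suff <- : linear_span rho = <[latR R p]>%VS by exact: mem_linear_span.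
  apply/esym/eqP; rewrite eqEdim -[\dim (linear_span _)]/(cone_dim rho) d1.
  rewrite dim_vline p0 andbT -memvE; apply: mem_linear_span.
  by rewrite -[latR R p]scale1r; exact: rp.
case/vlineP => c xE; have [c0|c0] := leP 0 c; first by exists c.
(* Both [x] and [- x] would lie in the ray, which is strictly convex. *)
have x0 : x = 0.
  by apply: crho => //; rewrite xE -scaleNr; apply: rp; rewrite oppr_ge0 ltW.
by exists 0; rewrite ?scale0r ?x0 //; exact: lexx.
Qed.

(** Take a minimal generating subset [K] of the given generators; minimality and strict convexity
    show that each member spans a one-dimensional face. *)
Lemma cone_generated_by_rays s : s \in cones Sigma ->
  exists k (K : {set 'I_k}) (rho : 'I_k -> set 'cV[R]_n),
    (forall i, i \in K -> cone_rays s (rho i)) /\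
    forall y, s y -> exists2 c : 'I_k -> R, forall i, 0 <= c i
      & y = \sum_(i in K) c i *: latR R (ray_gen (rho i)).
Proof.
move=> sS; have [rs cs] := fan_cone sS.
have [k [v0 sv]] := rational_coneP rs; have [A HA] := rational_cone_halfspaces rs.
pose v i := latR R (v0 i).
pose P (K : {set 'I_k}) := `[< forall y, s y ->
  exists2 c : 'I_k -> R, forall i, 0 <= c i & y = \sum_(i in K) c i *: v i >].
have sK (K : {set 'I_k}) (c : 'I_k -> R) : (forall i, 0 <= c i) ->
    s (\sum_(i in K) c i *: v i).
  move=> c0; apply/sv; exists (fun i => if i \in K then c i else 0).
    by move=> i; case: ifP.
  rewrite big_mkcond; apply: eq_bigr => i _; case: ifP => // _.
  by rewrite scale0r.
have svi i : s (v i).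
  by have := sK [set i]%SET (fun=> 1) (fun=> ler01); rewrite big_set1 scale1r.
have [K /minsetP[/asboolP PK Kmin]] : {K | minset P K}.
  apply: ex_minset; exists [set: 'I_k]%SET; apply/asboolP => y /sv[c c0 ->].
  by exists c => //; apply: eq_bigl => i; rewrite finset.inE.
have Kirr i : i \in K -> ~ exists2 d : 'I_k -> R, forall j, 0 <= d j &
    v i = \sum_(j in K | j != i) d j *: v j.
  move=> iK [d d0 vE]; suff /Kmin : P (K :\ i)%SET.
    move=> /(_ (finset.subsetDl _ _)) eK; by rewrite -eK !finset.inE eqxx in iK.
  apply/asboolP => y /PK[c c0 ->]; exists (fun j => c i * d j + c j).
    by move=> j; rewrite addr_ge0 ?mulr_ge0.
  rewrite (bigD1 i) //= {1}vE scaler_sumr -big_split /=.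
  apply: eq_big => [j|j _]; first by rewrite !finset.inE andbC.
  by rewrite scalerDl scalerA.
have v_neq0 i : i \in K -> v i != 0.
  move=> iK; apply/eqP => vi0; apply: (Kirr _ iK); exists (fun=> 0) => //.
  by rewrite vi0 big1 // => j _; rewrite scale0r.
pose rho i : set 'cV[R]_n := [set c *: v i | c in [set c : R | 0 <= c]].
have face_rho i : i \in K -> face (rho i) s.
  (* The sum of the inequalities tight at [v i] cuts out the smallest face through [v i]. *)
  move=> iK; pose w := \sum_(a <- A | pairing a (v i) == 0) a.
  exists w.
    move=> x /HA xA; rewrite pairing_suml big_seq_cond sumr_ge0 // => a /andP[aA _].
    exact: xA.
  apply/seteqP; split=> [_ [c c0 <-]|x [sx]].
    split; first exact: (halfspacesZ HA).
    rewrite /= pairingZr pairing_suml big1 ?mulr0 // => a /eqP //.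
  rewrite /= pairing_suml big_seq_cond => /eqP; rewrite psumr_eq0; last first.
    by move=> a /andP[aA _]; apply: (HA x).1.
  move=> /allP wx.
  have [|e e0 se] := halfspaces_sub_small HA (svi i) sx.
    move=> a aA /eqP av; have /implyP := wx _ aA.
    by rewrite aA av => /(_ isT)/eqP.
  have [c c0 xE] := PK _ sx; have [d d0 yE] := PK _ se.
  (* Coefficients over [K] of [v i], written as [e *: x] plus [v i - e *: x]. *)
  pose m j := e * c j + d j.
  have m0 j : 0 <= m j by rewrite addr_ge0 ?mulr_ge0 // ltW.
  have vE : v i = \sum_(j in K) m j *: v j.
    rewrite -[LHS](subrK (e *: x)) yE xE scaler_sumr -big_split /=.
    by apply: eq_bigr => j _; rewrite scalerA -scalerDl addrC.
  have vE' : (1 - m i) *: v i = \sum_(j in K | j != i) m j *: v j.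
    by apply/eqP; rewrite scalerBl scale1r subr_eq addrC {1}vE (bigD1 i).
  (* Otherwise solving for [v i] would make it redundant in [K]. *)
  have m1 : 1 <= m i.
    rewrite leNgt; apply/negP => m1; apply: (Kirr _ iK).
    have m1' : 0 < 1 - m i by rewrite subr_gt0.
    exists (fun j => (1 - m i)^-1 * m j).
      by move=> j; rewrite mulr_ge0 // invr_ge0 ltW.
    under eq_bigr do rewrite -scalerA.
    by rewrite -scaler_sumr -vE' scalerA mulVf ?scale1r // gt_eqF.
  have sKi (f : 'I_k -> R) : (forall j, 0 <= f j) ->
      s (\sum_(j in K | j != i) f j *: v j).
    move=> f0; have := sK (K :\ i)%SET f f0; congr (s _).
    by apply: eq_bigl => j; rewrite !finset.inE andbC.
  (* This is the part of [e *: x] off [v i]. Since [m i] is at least 1, its negative is again a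
     nonnegative combination, so strict convexity kills it. *)
  have z0 : \sum_(j in K | j != i) (e * c j) *: v j = 0.
    apply: cs; first by apply: sKi => j; rewrite mulr_ge0 // ltW.
    rewrite (_ : - _ = \sum_(j in K | j != i) d j *: v j + (m i - 1) *: v i).
      apply: (halfspacesD HA); first exact: sKi.
      by apply: (halfspacesZ HA); rewrite ?subr_ge0.
    rewrite -opprB scaleNr vE'.
    rewrite [X in _ = _ - X](eq_bigr (fun j => (e * c j) *: v j + d j *: v j)).
      by rewrite big_split /= opprD addrCA subrr addr0.
    by move=> j _; rewrite scalerDl.
  exists (c i); first exact: c0.
  rewrite xE (bigD1 i) //=.
  have : e *: \sum_(j in K | j != i) c j *: v j = 0.
    by rewrite scaler_sumr -[RHS]z0; apply: eq_bigr => j _; rewrite scalerA.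
  by move=> /eqP; rewrite scaler_eq0 gt_eqF //= => /eqP ->; rewrite addr0.
have rho_ray i : i \in K -> cone_rays s (rho i).
  move=> iK; split; first exact: face_rho.
  by rewrite /rho cone_dim_ray ?v_neq0.
exists k, K, rho; split=> // y /PK[c c0 ->].
have /choice[g Hg] : forall i, exists g : R, i \in K ->
    0 <= g /\ v i = g *: latR R (ray_gen (rho i)).
  move=> i; have [iK|] := boolP (i \in K); last by exists 0.
  have [fi di] := rho_ray _ iK.
  have : rho i (v i) by exists 1; rewrite ?scale1r //; exact: ler01.
  rewrite {1}(fan_ray_gen (fan_face sS fi) di) => -[g g0 gE].
  by exists g.
exists (fun i => if i \in K then c i * g i else 0).
  by move=> i; case: ifP => // iK; rewrite mulr_ge0 //; case: (Hg i iK).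
apply: eq_bigr => i iK; rewrite iK -scalerA.
by case: (Hg i iK) => _ <-.
Qed.

Lemma face_sub s t : face t s -> t `<=` s.
Proof. by case=> w _ -> x []. Qed.

(** The intersection with [t] is a face of [s] through a relative interior point, hence all of
    [s]. *)
Lemma relint_sub s t x : s \in cones Sigma -> t \in cones Sigma ->
  relint s x -> t x -> s `<=` t.
Proof.
move=> sS tS [sx xw] tx; have [[w w0 E] _] := fan_meet sS tS.
have : (s `&` t) x by [].
rewrite E => -[_ wx] y sy; suff : (s `&` t) y by case.
by rewrite E; split=> //; exact: xw.
Qed.

Lemma relint_inj s t x : s \in cones Sigma -> t \in cones Sigma ->
  relint s x -> relint t x -> s = t.
Proof.
move=> sS tS rs rt; apply/seteqP; split.
  by apply: relint_sub rs _ => //; case: rt.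
by apply: relint_sub rt _ => //; case: rs.
Qed.

(** A cone of least dimension containing [x] works: a supporting hyperplane through [x] cuts out a
    cone of the fan that still contains [x], hence has the same span. *)
Lemma mem_relint_fan x : complete Sigma -> exists2 s, s \in cones Sigma & relint s x.
Proof.
move=> cS; pose P d := `[< exists s, [/\ s \in cones Sigma, s x & cone_dim s = d] >].
have exP : exists d, P d.
  by have [s sS sx] := cS x; exists (cone_dim s); apply/asboolP; exists s.
have [d /asboolP[s [sS sx ds]] dmin] := ex_minnP exP.
exists s => //; split=> // w w0 wx y sy.
pose t := s `&` [set z | pairing w z = 0].
have tS : t \in cones Sigma by apply: fan_face sS _; exists w.
have dt : (d <= cone_dim t)%N by apply: dmin; apply/asboolP; exists t.
apply: (@pairing_linear_span0 t) => [z []//|].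
suff -> : linear_span t = linear_span s by exact: mem_linear_span.
apply/eqP; rewrite eqEdim -[\dim (linear_span s)]/(cone_dim s) ds dt andbT.
by apply: linear_span_sub => z [sz _]; exact: mem_linear_span.
Qed.

Lemma cone_rays_sub s t rho : s \in cones Sigma -> t \in cones Sigma ->
  s `<=` t -> cone_rays s rho -> cone_rays t rho.
Proof.
move=> sS tS st [fr d1]; split=> //; have rS := fan_face sS fr.
have [_] := fan_meet rS tS; rewrite (_ : rho `&` t = rho) //.
by apply/setIidPl => x /(face_sub fr)/st.
Qed.

End FanGeometry.

(** * Polytopes and tropical bundles *)

Section Polytopes.
Variables (R : realType) (n : nat).
Implicit Types (u : 'rV[R]_n) (x : 'cV[R]_n).

Lemma cone_dim_strict_cell (S : seq ('rV[R]_n * R)) :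
  (forall p, p \in S -> p.2 != 0) -> cell S !=set0 -> cone_dim (cell S) = n.
Proof.
elim: S => [|p S IH] S0 C0.
  by rewrite (_ : cell [::] = setT) ?cone_dim_setT // -subTset => x _ p.
move: C0; rewrite cell_cons setIC => C0.
rewrite cone_dim_sg ?S0 ?mem_head //; last exact: open_cone_cell.
apply: IH; first by move=> q qS; apply: S0; rewrite inE qS orbT.
by case: C0 => x [Sx _]; exists x.
Qed.

Variables (k : nat) (p : 'I_k.+1 -> 'rV[R]_n).

Definition hull : set 'rV[R]_n := [set \sum_i c i *: p i |
  c in [set c : 'I_k.+1 -> R | (forall i, 0 <= c i) /\ \sum_i c i = 1]].

Lemma hull_vertex i : hull (p i).
Proof.
exists (fun j => (j == i)%:R); first split=> [j|]; first exact: ler0n.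
  by rewrite (bigD1 i) //= eqxx big1 ?addr0 // => j /negPf ->.
rewrite (bigD1 i) //= eqxx scale1r big1 ?addr0 // => j /negPf ->.
by rewrite scale0r.
Qed.

Lemma hull_pairing_lt u x a : hull u ->
  (forall i, pairing (p i) x < a) -> pairing u x < a.
Proof.
case=> c [c0 c1] <- lt; rewrite pairing_suml -[a]mul1r -c1 mulr_suml.
rewrite -subr_gt0 -sumrB; under eq_bigr do rewrite pairingZl -mulrBr.
have nn i : 0 <= c i * (a - pairing (p i) x).
  by rewrite mulr_ge0 // subr_ge0 ltW.
rewrite lt_def sumr_ge0 // andbT psumr_eq0 //; apply/negP => /allP z.
have := oner_neq0 R; rewrite -c1 big1 ?eqxx // => i _.
have /implyP/(_ isT) := z i (mem_index_enum i).
by rewrite mulf_eq0 subr_eq0 => /orP[/eqP//|/eqP ae]; have := lt i; rewrite ae ltxx.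
Qed.

(** A linear form attains its maximum at one of the listed points, so the threshold is decided by
    finitely many signs. *)
Lemma polytope_support_ge x a :
  (a <= polytope_support hull x) = [exists i, a <= pairing (p i) x].
Proof.
have [i0 _ Hmax] := @arg_maxP _ R _ ord0 xpredT (fun i => pairing (p i) x) isT.
have ub : ubound [set pairing u x | u in hull] (pairing (p i0) x).
  move=> _ [u hu <-]; rewrite leNgt; apply/negP => lt.
  have := @hull_pairing_lt u x (pairing u x) hu; rewrite ltxx => h.
  suff : false by []. apply: h => i; apply: le_lt_trans lt; exact: Hmax.
apply/idP/existsP => [le|[i ai]].
  exists i0; apply: le_trans le _; apply: ge_sup => //.
  by exists (pairing (p i0) x), (p i0) => //; exact: hull_vertex.
apply: le_trans ai _; apply: ub_le_sup; first by exists (pairing (p i0) x).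
by exists (p i) => //; exact: hull_vertex.
Qed.

(* Gordan's alternative, by applying [cone_halfspaces] to the cone over the
   polytope in one dimension more. *)
Lemma hull_separation u : ~ hull u -> exists x, forall i, pairing (p i - u) x < 0.
Proof.
(* Lifting to height 1 turns convex combinations into conic ones; [u], translated to the origin,
   becomes [y0]. *)
move=> hu; pose v i : 'cV[R]_(n + 1) := col_mx (p i - u)^T 1%:M.
have [A HA] := cone_halfspaces v.
pose y0 : 'cV[R]_(n + 1) := col_mx 0 1%:M.
have /HA/existsNP[a /not_implyP[aA /negP]] :
    ~ exists2 c : 'I_k.+1 -> R, forall i, 0 <= c i & y0 = \sum_i c i *: v i.
  case=> c c0 E; apply: hu.
  have E1 : \sum_i c i = 1.
    have := congr1 (fun z => dsubmx z ord0 ord0) E.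
    rewrite /y0 col_mxKd mxE eqxx mulr1n => E1; rewrite [RHS]E1 linear_sum summxE.
    by apply: eq_bigr => i _; rewrite linearZ /= col_mxKd !mxE eqxx mulr1.
  have E2 : \sum_i c i *: (p i - u) = 0.
    have := congr1 (fun z => (usubmx z)^T) E.
    rewrite /y0 col_mxKu trmx0 => E2; rewrite [RHS]E2 !linear_sum.
    by apply: eq_bigr => i _; rewrite /= !linearZ /= col_mxKu trmxK.
  exists c => //; apply/eqP; rewrite -subr_eq0 -[u in _ - u]scale1r -E1 scaler_suml.
  by rewrite -sumrB -[X in _ == X]E2; apply/eqP; apply: eq_bigr => i _; rewrite scalerBr.
rewrite -ltNge => ay0.
have av i : 0 <= pairing a (v i).
  apply: (HA (v i)).1 => //; exists (fun j => (j == i)%:R) => [j|]; first exact: ler0n.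
  rewrite (bigD1 i) //= eqxx scale1r big1 ?addr0 // => j /negPf ->.
  by rewrite scale0r.
have pa (q : 'rV[R]_n) t : pairing a (col_mx q^T (t%:M : 'M_1)) =
    pairing q (lsubmx a)^T + t * rsubmx a ord0 ord0.
  rewrite /pairing -[a in LHS]hsubmxK mul_row_col mxE; congr (_ + _).
    by rewrite -[lsubmx a in LHS]trmxK -trmx_mul mxE.
  by rewrite mul_mx_scalar mxE.
(* The last entry of [a] is negative by [ay0], so its other entries pair positively with each
   [p i - u]; hence the minus sign. *)
exists (- (lsubmx a)^T) => i; rewrite pairingNr oppr_lt0.
have := av i; rewrite pa mul1r; move: ay0; rewrite /y0 -(trmx0 R 1 n) pa.
by rewrite [pairing 0 _]/pairing mul0mx mxE add0r mul1r; lra.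
Qed.

Lemma euler_sum_hull L u : (forall i, p i - u \in L) ->
  euler_sum L setT (fun x => (pairing u x <= polytope_support hull x)%R%:R) =
  (-1) ^+ n * (u \in hull)%:R.
Proof.
move=> pL; pose S := [seq (p i - u, -1 : R) | i : 'I_k.+1].
have SE x : (x \in cell S) = [forall i, pairing (p i - u) x < 0].
  apply/idP/forallP => [|xS].
    rewrite inE => xS i; rewrite -sgr_cp0; apply/eqP.
    by apply: (xS (_, _)); rewrite map_f ?mem_enum.
  rewrite inE => _ /mapP[i _ ->]; rewrite /sgset /=; apply/eqP; rewrite sgr_cp0; exact: xS.
rewrite (@eq_euler_sum _ _ _ _ _ (fun x => 1 - (x \in cell S)%:R)); last first.
  move=> x _; rewrite polytope_support_ge SE.
  rewrite (_ : [forall i, _] = ~~ [exists i, pairing u x <= pairing (p i) x]).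
    by case: existsP => _; rewrite ?subr0 ?subrr.
  by rewrite negb_exists; apply: eq_forallb => i; rewrite pairingBl subr_lt0 ltNge.
rewrite euler_sumB euler_sum1 ?euler_sum_cell; try exact: open_coneT; last first.
  by move=> _ /mapP[i _ ->]; split; [exact: pL|rewrite !inE eqxx !orbT].
have T0 : [set: 'cV[R]_n] !=set0 by exists 0.
rewrite setTI (cell_signE T0) cone_dim_setT.
have [hu|hu] := pselect (hull u).
  rewrite mem_set // (_ : cell S = set0) ?cell_sign0 ?subr0 ?mulr1 //.
  rewrite -subset0 => x /mem_set; rewrite SE => /forallP xS.
  have := @hull_pairing_lt u x (pairing u x) hu; rewrite ltxx => h.
  suff : false by []. apply: h => i.
  by have := xS i; rewrite pairingBl subr_lt0.
rewrite memNset //= mulr0; have [x xS] := hull_separation hu.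
have S0 : cell S !=set0.
  by exists x; apply/set_mem; rewrite SE; apply/forallP.
rewrite (cell_signE S0) cone_dim_strict_cell ?subrr // => _ /mapP[i _ ->].
by rewrite oppr_eq0 oner_eq0.
Qed.

End Polytopes.

Section Bundles.
Variables (R : realType) (n : nat) (Sigma : fan R n) (r : nat).
Variable E : tropical_bundle Sigma r.
Implicit Types (s : set 'cV[R]_n) (b : 'I_r -> ground E) (u : 'I_r -> 'rV[int]_n).
Notation splits s b u := (splits_on (mat E) (filt E) s b u).

Lemma filt_support s b u rho (i : int) g : splits s b u -> cone_rays s rho ->
  (g \in filt E rho i) =
  (basis_support (mat E) b g \subset [set j | i <= pairing (u j) (ray_gen rho)]%SET).
Proof.
case=> binj bB bF srho; rewrite -(basis_supportP binj bB) bF //.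
Qed.

Lemma ray_gen_mem s rho : s \in cones Sigma -> cone_rays s rho ->
  s (latR R (ray_gen rho)).
Proof.
move=> sS [fr d1]; apply: (face_sub fr).
rewrite [X in X _](fan_ray_gen (fan_face sS fr) d1).
by exists 1; rewrite ?scale1r //; exact: ler01.
Qed.

(** The support of an element of the flat consists of indices passing the test on every ray, hence
    on [s], which the rays generate. So the flat lies between this part of the basis and its
    closure. *)
Lemma mrank_H0 s b u w : s \in cones Sigma -> splits s b u ->
  mrank (mat E) (H0 E s w) =
  #|[set j | `[< forall y, s y -> 0 <= pairing (latR R (u j) - latR R w) y >]]%SET|.
Proof.
move=> sS sp; have [binj bB _] := sp.
apply: (mrank_basis_sandwich binj bB).
  apply/fintype.subsetP => _ /imsetP[j + ->]; rewrite !finset.inE => /asboolP jJ.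
  apply/asboolP => rho srho; rewrite (filt_support _ _ sp srho).
  apply: fintype.subset_trans (basis_support_basis binj bB j) _.
  rewrite finset.sub1set finset.inE -(ler_int R) -!pairing_latR -subr_ge0 -pairingBl.
  exact: (jJ _ (ray_gen_mem sS srho)).
move=> x; rewrite finset.inE => /asboolP xH; apply/fintype.subsetP => j jx.
rewrite finset.inE; apply/asboolP.
have [k [K [rho [rhoS gen]]]] := cone_generated_by_rays sS.
move=> _ /gen[c c0 ->]; rewrite pairing_sumr sumr_ge0 // => i iK.
rewrite pairingZr mulr_ge0 // pairingBl subr_ge0 !pairing_latR ler_int.
have := xH _ (rhoS i iK); rewrite (filt_support _ _ sp (rhoS i iK)).
by move=> /fintype.subsetP/(_ j jx); rewrite finset.inE.
Qed.

(* Both cardinals are the rank of the set of all elements lying in the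
   intersection of some [F^(rho_i)_(z_i)] with [sum c_i z_i >= a]. *)
Lemma splits_threshold s b u b' u' y (a : R) : s \in cones Sigma ->
  splits s b u -> splits s b' u' -> s y ->
  #|[set j | (a <= pairing (latR R (u j)) y)%R]%SET| =
  #|[set j | (a <= pairing (latR R (u' j)) y)%R]%SET|.
Proof.
move=> sS sp sp' sy.
have [k [K [rho [rhoS gen]]]] := cone_generated_by_rays sS.
have [c c0 yE] := gen _ sy.
pose X := [set g | `[< exists2 z : 'I_k -> int, a <= \sum_(i in K) c i * (z i)%:~R
  & forall i, i \in K -> g \in filt E (rho i) (z i) >]]%SET.
suff main (b1 : 'I_r -> ground E) u1 : splits s b1 u1 ->
    mrank (mat E) X = #|[set j | (a <= pairing (latR R (u1 j)) y)%R]%SET|.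
  by rewrite -(main _ _ sp) -(main _ _ sp').
move=> sp1; have [binj bB _] := sp1.
have uy j : pairing (latR R (u1 j)) y =
    \sum_(i in K) c i * (pairing (u1 j) (ray_gen (rho i)))%:~R.
  by rewrite yE pairing_sumr; apply: eq_bigr => i _; rewrite pairingZr pairing_latR.
apply: (mrank_basis_sandwich binj bB).
  apply/fintype.subsetP => _ /imsetP[j + ->]; rewrite !finset.inE => jJ.
  apply/asboolP; exists (fun i => pairing (u1 j) (ray_gen (rho i))).
    by rewrite -uy.
  move=> i iK; rewrite (filt_support _ _ sp1 (rhoS i iK)).
  apply: fintype.subset_trans (basis_support_basis binj bB j) _.
  by rewrite finset.sub1set finset.inE.
move=> x; rewrite finset.inE => /asboolP[z az xz]; apply/fintype.subsetP => j jx.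
rewrite finset.inE uy; apply: le_trans az _; apply: ler_sum => i iK.
rewrite ler_wpM2l // ler_int; have := xz i iK.
rewrite (filt_support _ _ sp1 (rhoS i iK)).
by move=> /fintype.subsetP/(_ j jx); rewrite finset.inE.
Qed.

Lemma splits_sub s t b u : s \in cones Sigma -> t \in cones Sigma ->
  s `<=` t -> splits t b u -> splits s b u.
Proof.
move=> sS tS st [binj bB bF]; split=> // rho i srho; apply: bF.
exact: (cone_rays_sub sS tS st).
Qed.

End Bundles.

Section Threshold.
Variable R : realType.

(** The device that extracts counts from an identity in Z[R]: an additive map, made a finite sum by
    letting [X] list every exponent once. *)
Lemma sum_mcoeff_threshold (I : eqType) (l : seq I) (m : I -> int) (k : I -> R)
    (X : seq R) (a : R) : uniq X -> {in l, forall i, k i \in X} ->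
  \sum_(x <- X | a <= x) (\sum_(i <- l) << m i *g k i >> : {malg int[R]})@_x =
  \sum_(i <- l) m i * (a <= k i)%R%:R.
Proof.
move=> uX kX; under eq_bigr do rewrite raddf_sum /=.
rewrite exchange_big [LHS]big_seq [RHS]big_seq; apply: eq_bigr => i il.
case: (boolP (a <= k i)) => ak.
  rewrite -big_filter (bigD1_seq (k i)) ?filter_uniq ?mem_filter ?ak ?kX //=.
  rewrite mcoeffUU mulr1 big1 ?addr0 //.
  by move=> x xk; rewrite mcoeffU eq_sym (negPf xk) mulr0n.
rewrite mulr0 big1 // => x ax; rewrite mcoeffU.
by case: eqP => [kx|]; rewrite ?mulr0n //; rewrite kx ax in ak.
Qed.

End Threshold.

(** * Comparison of the two integrals *)

(** Allowing any larger [L] lets the hyperplanes of several polytopes be merged. *)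
Lemma polytope_arrangement (R : realType) n (u : 'rV[R]_n) (P : set 'rV[R]_n) :
  polytope P -> exists A : seq 'rV[R]_n, forall L, {subset A <= L} ->
    euler_sum L setT (fun x => (pairing u x <= polytope_support P x)%R%:R) =
    (-1) ^+ n * (u \in P)%:R.
Proof.
case=> k [p ->]; exists [seq p i - u | i : 'I_k.+1] => L AL.
by apply: euler_sum_hull => i; apply/AL/map_f; rewrite mem_enum.
Qed.

(** The value at [x] may come from another cone [t]. As [x] is relatively interior to [s], [t]
    contains [s], its splitting restricts to [s], and [splits_threshold] applies. *)
Lemma mv_support_threshold (R : realType) n (Sigma : fan R n) r
    (E : tropical_bundle Sigma r) (c : seq (int * set 'rV[R]_n)) x a s b u :
  mv_support E x = chain_support c x -> s \in cones Sigma -> relint s x ->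
  splits_on (mat E) (filt E) s b u ->
  \sum_(p <- c) p.1 * (a <= polytope_support p.2 x)%R%:R =
  \sum_(j < r) (a <= pairing (latR R (u j)) x)%R%:R.
Proof.
move=> Ec sS rx sp; have [sx _] := rx.
have card (u1 : 'I_r -> 'rV[int]_n) :
    \sum_(j < r) (a <= pairing (latR R (u1 j)) x)%R%:R =
    #|[set j | (a <= pairing (latR R (u1 j)) x)%R]%SET|%:R :> int.
  rewrite -sum1_card natr_sum [RHS]big_mkcond; apply: eq_bigr => j _.
  by rewrite finset.inE; case: ifP.
have [t [b' [u' [tS tx sp' E']]]] : [set h | exists t b' u',
    [/\ t \in cones Sigma, t x, splits_on (mat E) (filt E) t b' u'
    & h = \sum_(j < r) << pairing (latR R (u' j)) x >>]] (mv_support E x).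
  rewrite /mv_support; set Q := (X in xget _ X); apply: (@xgetPex _ _ Q).
  by exists (\sum_(j < r) << pairing (latR R (u j)) x >>), s, b, u.
have st := relint_sub sS tS rx tx.
rewrite card (splits_threshold a sS sp (splits_sub sS tS st sp') sx) -card.
(* The exponents of both expressions, so that one additive map reads both. *)
pose X := undup ([seq polytope_support p.2 x | p <- c] ++
  [seq pairing (latR R (u' j)) x | j : 'I_r]).
rewrite -(@sum_mcoeff_threshold _ _ _ _ _ X) ?undup_uniq; last first.
- by move=> p pc; rewrite mem_undup mem_cat (map_f (fun p => polytope_support p.2 x) pc).
- by [].
transitivity (\sum_(y <- X | a <= y) (mv_support E x)@_y).
  by rewrite Ec.
rewrite E' (@sum_mcoeff_threshold _ _ _ (fun=> 1) _ X) ?undup_uniq; last first.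
- move=> j _; rewrite mem_undup mem_cat; apply/orP; right.
  by apply/mapP; exists j; rewrite ?mem_enum.
- by [].
by apply: eq_bigr => j _; rewrite mul1r.
Qed.

Theorem theorem1p1 (R : realType) (n : nat) (Sigma : fan R n)
    (HSigma : complete Sigma) (r : nat) (E : tropical_bundle Sigma r)
    (alpha : 'rV[R]_n -> int) (Halpha : is_convex_chain_of E alpha)
    (u : 'rV[int]_n) :
  euler_char E u = alpha (latR R u).
Proof.
have [c [cP -> Ec]] := Halpha; set uR := latR R u.
have /choice[LP HLP] : forall P : set 'rV[R]_n, exists A : seq 'rV[R]_n,
    polytope P -> forall L, {subset A <= L} ->
    euler_sum L setT (fun x => (pairing uR x <= polytope_support P x)%R%:R) =
    (-1) ^+ n * (uR \in P)%:R.
  move=> P; have [/(polytope_arrangement uR)[A HA]|nP] := pselect (polytope P).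
    by exists A.
  by exists [::].
have /choice[LC HLC] : forall s, exists A : seq 'rV[R]_n,
    s \in cones Sigma -> halfspaces A s.
  move=> s.
  have [/fan_cone[/rational_cone_halfspaces[A HA] _]|_] := boolP (s \in cones Sigma).
    by exists A.
  by exists [::].
have /choice[U HU] : forall s, exists U : 'I_r -> 'rV[int]_n, s \in cones Sigma ->
    exists b, splits_on (mat E) (filt E) s b U.
  move=> s; have [/(filt_split E)[b [U sp]]|_] := boolP (s \in cones Sigma).
    by exists U => _; exists b.
  by exists (fun=> 0).
pose L := flatten [seq LP p.2 | p <- c] ++ flatten [seq LC s | s <- cones Sigma] ++
  flatten [seq [seq latR R (U s j) - uR | j : 'I_r] | s <- cones Sigma].
have LPL p : p \in c -> {subset LP p.2 <= L}.
  move=> pc a ap; rewrite mem_cat; apply/orP; left.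
  by apply/flattenP; exists (LP p.2); rewrite ?map_f.
have LCL s : s \in cones Sigma -> {subset LC s <= L}.
  move=> sS a ap; rewrite !mem_cat; apply/orP; right; apply/orP; left.
  by apply/flattenP; exists (LC s); rewrite ?map_f.
have UL s j : s \in cones Sigma -> latR R (U s j) - uR \in L.
  move=> sS; rewrite !mem_cat; apply/orP; right; apply/orP; right.
  apply/flattenP; exists [seq latR R (U s j) - uR | j : 'I_r].
    exact: (map_f (fun s => [seq latR R (U s j) - uR | j : 'I_r])).
  by apply: map_f; rewrite mem_enum.
have sgn2 k : (-1) ^+ k * (-1) ^+ k = 1 :> int by rewrite -expr2 sqrr_sign.
(* The inner sign is absorbed by the integrals over the polytopes; the outer one later turns
   dimension into codimension. *)
rewrite (_ : chain_fun c uR = (-1) ^+ n * ((-1) ^+ n * chain_fun c uR)); last first.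
  by rewrite mulrA sgn2 mul1r.
rewrite /chain_fun [X in _ = _ * X]mulr_sumr.
have -> : \sum_(p <- c) (-1) ^+ n * (p.1 * (uR \in p.2)%:R) =
    \sum_(p <- c) p.1 * euler_sum L setT
      (fun x => (pairing uR x <= polytope_support p.2 x)%R%:R).
  rewrite [LHS]big_seq [RHS]big_seq; apply: eq_bigr => p pc.
  by rewrite (HLP _ (cP _ pc) _ (LPL _ pc)) mulrCA.
rewrite -euler_sum_lin.
(* By completeness [x] is relatively interior to exactly one cone, and only that cone contributes at
   [x]. *)
rewrite (@eq_euler_sum _ _ _ _ _ (fun x => \sum_(s <- cones Sigma) \sum_(j < r)
  (x \in relint s)%:R * (0 <= pairing (latR R (U s j) - uR) x)%R%:R)); last first.
  move=> x _; have [s sS rx] := mem_relint_fan x HSigma.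
  have [b sp] := HU s sS.
  rewrite (mv_support_threshold _ (Ec x) sS rx sp).
  rewrite (bigD1_seq s) ?fset_uniq //= [X in _ + X]big_seq_cond.
  rewrite [X in _ + X]big1 ?addr0 => [|t /andP[tS ts]].
    by apply: eq_bigr => j _; rewrite mem_set // mul1r pairingBl subr_ge0.
  apply: big1 => j _; rewrite memNset ?mul0r // => rt.
  by rewrite (relint_inj tS sS rt rx) eqxx in ts.
rewrite euler_sum_sum mulr_sumr [LHS]big_seq [RHS]big_seq.
apply: eq_bigr => s sS; rewrite euler_sum_sum.
have [rs _] := fan_cone sS; have [b sp] := HU s sS.
under [in RHS]eq_bigr do
  rewrite (euler_sum_relint rs (HLC _ sS) (LCL _ sS) (UL _ _ sS)).
rewrite -mulr_sumr mulrA; congr (_ * _).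
  have nE : (-1) ^+ n = (-1) ^+ (n - cone_dim s) * (-1) ^+ cone_dim s :> int.
    by rewrite -exprD subnK ?cone_dim_le.
  by rewrite nE -mulrA sgn2 mulr1.
rewrite (mrank_H0 _ sS sp) -natz -sum1_card natr_sum [LHS]big_mkcond.
by apply: eq_bigr => j _; rewrite finset.inE; case: ifP.
Qed.
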